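(* Assume (A$_1$)–(A$_9$). If $f$ is in the RW-fine core of $\mathcal E$, then $f$ is in the ex-post core of $\mathcal E$.
   Context: Standing setup (mixed economy $\mathcal E$). $\Omega$ is a finite set of states with a $\sigma$-algebra $\mathcal F$. $(T,\Sigma,\mu)$ is a complete, finite, positive measure space of agents; $T=T_0\cup T_1$, $T_0$ atomless, $T_1$ a countable union of $\mu$-atoms, each atom being one agent. $Y$ is an ordered Banach space whose positive cone $Y_+$ has nonempty interior; $x\gg0$ means $x\in\operatorname{int}Y_+$. Each agent $t$ has a partition $\Pi_t$ of $\Omega$ generating $\mathcal F_t$, a utility $U_t:\Omega\times Y_+\to\mathbb R$, an endowment $a(t,\cdot):\Omega\to Y_+$ constant on elements of $\Pi_t$, a prior $q_t$ with $q_t(\omega)>0$; $V_t(x)=\sum_\omega U_t(\omega,x(\omega))q_t(\omega)$; $a(\cdot,\omega)$ is Bochner integrable on $T$. A coalition is $S\in\Sigma$ with $\mu(S)>0$. In this setting an $S$-allocation is $f:S\times\Omega\to Y_+$ with $f(\cdot,\omega)$ Bochner integrable for each $\omega$ and $f(t,\cdot)$ $\mathcal F$-measurable for a.e. $t\in S$ ($T$-allocations are allocations; feasible means $\int_T f(\cdot,\omega)d\mu\le\int_T a(\cdot,\omega)d\mu$ for all $\omega$). For a partition $\mathcal Q$, $T_{\mathcal Q}=\{t:\Pi_t=\mathcal Q\}$; $\mathfrak P_S=\{\mathcal Q:S\cap T_{\mathcal Q}\ne\emptyset\}$; $\bigvee\mathfrak P_S$ is the $\sigma$-algebra generated by the coarsest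 common refinement of the partitions in $\mathfrak P_S$. A communication system for $S$ is a family $\{\mathcal G_t\}_{t\in S}$ of sub-$\sigma$-algebras of $\mathcal F$ with $\{t\in S:\mathcal G_t=\mathcal H\}\in\Sigma$ for every $\sigma$-algebra $\mathcal H\subseteq\mathcal F$ and $\mathcal F_t\subseteq\mathcal G_t\subseteq\bigvee\mathfrak P_S$ for a.e. $t\in S$. $\mathbb E_t[\,\cdot\,|\mathcal H]$ is conditional expectation with respect to $q_t$. An allocation $f$ is RW-fine blocked by $S$ if there are an $S$-allocation $g$, a communication system $\{\mathcal G_t\}_{t\in S}$ and a nonempty $A\in\bigcap_{t\in S}\mathcal G_t$ with $\int_S g(\cdot,\omega)d\mu=\int_S a(\cdot,\omega)d\mu$ for all $\omega\in A$ and $\mathbb E_t[U_t(\cdot,g(t,\cdot))|\mathcal G_t](\omega)>\mathbb E_t[U_t(\cdot,f(t,\cdot))|\mathcal G_t](\omega)$ for all $\omega\in A$ and a.e. $t\in S$; the RW-fine core is the set of feasible allocations not RW-fine blocked by any coalition. An allocation $f$ is ex-postly blocked by $S$ if there exist an $S$-allocation $g$ and $\omega_0\in\Omega$ with $\int_S g(\cdot,\omega_0)d\mu=\int_S a(\cdot,\omega_0)d\mu$ and $U_t(\omega_0,g(t,\omega_0))>U_t(\omega_0,f(t,\omega_0))$ for a.e. $t\in S$; the ex-post core is the set of feasible allocations not ex-postly blocked by any coalition. (A$_1$): $t\mapsto q_t$ is measurable and $T_{\mathcal Q}\in\Sigma$ for every partition $\mathcal Q$. (A$_2$): for each $\omega$,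 $t\mapsto U_t(\omega,x)$ is measurable and $U_t(\omega,\cdot)$ is norm-continuous. (A$_3$): for all $(t,\omega)$ and $x,y\in Y_+$ with $y\gg0$, $U_t(\omega,x+y)>U_t(\omega,x)$. (A$_4$): for each $(t_0,\omega_0)\in T_1\times\Omega$ and each coalition $S$ with $\mu(S\cap T_1)>0$ and $S$-assignment $f$ with $\int_S f(\cdot,\omega)d\mu\le\int_S a(\cdot,\omega)d\mu$ for all $\omega$, $U_{t_0}(\omega_0,\hat f(\omega_0))\ge\frac{1}{\mu(S\cap T_1)}\int_{S\cap T_1}U_{t_0}(\omega_0,f(\cdot,\omega_0))d\mu$ where $\hat f(\omega_0)=\frac{1}{\mu(S\cap T_1)}\int_{S\cap T_1}f(\cdot,\omega_0)d\mu$. (A$_5$): $a(t,\omega)\gg0$ for all $(t,\omega)$. (A$_6$): all large agents have the same characteristics. (A$_7$): $T_1$ contains at least two atoms. (A$_8$): $\bigvee\mathfrak P_T=\mathcal F$. (A$_9$): for a.e. $t$ and all $x\in Y_+$, $U_t(\cdot,x)$ is $\mathcal F$-measurable. *)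

(* Defs.v *)
From HB Require Import structures.
From mathcomp Require Import all_boot all_order all_algebra.
From mathcomp Require Import all_classical all_reals all_analysis.
Set Implicit Arguments. Unset Strict Implicit. Unset Printing Implicit Defensive.
Import Order.TTheory GRing.Theory Num.Theory.
Import numFieldNormedType.Exports.
Local Open Scope classical_set_scope.
Local Open Scope ring_scope.

Definition positive_cone (R : realType) (Y : normedModType R) (Yp : set Y) : Prop :=
  [/\ Yp 0,
      (forall x y, Yp x -> Yp y -> Yp (x + y)),
      (forall (l : R) x, 0 <= l -> Yp x -> Yp (l *: x)),
      (forall x, Yp x -> Yp (- x) -> x = 0)
    & closed Yp].

Definition yle (R : realType) (Y : normedModType R) (Yp : set Y) (x y : Y) : Prop :=
  Yp (y - x).

Definition ygg0 (R : realType) (Y : normedModType R) (Yp : set Y) (x : Y) : Prop :=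
  (Yp°) x.

Definition bochner_int (R : realType) d (T : measurableType d)
  (Y : normedModType R) (mu : {measure set T -> \bar R}) (S : set T)
  (f : T -> Y) (y : Y) : Prop :=
  exists (k : nat -> nat) (A : nat -> nat -> set T) (c : nat -> nat -> Y),
  [/\ (forall n i, measurable (A n i)),
      {ae mu, forall t, S t ->
          (\sum_(i < k n) (\1_(A n i) t : R) *: c n i) @[n --> \oo] --> f t},
      (\int[mu]_(t in S) (`|f t - \sum_(i < k n) (\1_(A n i) t : R) *: c n i|)%:E)%E
          @[n --> \oo] --> 0%E
    & (\sum_(i < k n) fine (mu (A n i `&` S)) *: c n i) @[n --> \oo] --> y].

Definition bochner_integrable (R : realType) d (T : measurableType d)
  (Y : normedModType R) (mu : {measure set T -> \bar R}) (S : set T)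
  (f : T -> Y) : Prop := exists y, bochner_int mu S f y.

Definition is_partition (Om : finType) (Q : set (set Om)) : Prop :=
  [/\ (forall B, Q B -> B !=set0),
      (forall B C, Q B -> Q C -> B `&` C !=set0 -> B = C)
    & (forall w, exists B, Q B /\ B w)].

Definition sub_sigma (Om : finType) (F H : set (set Om)) : Prop :=
  sigma_algebra setT H /\ H `<=` F.

Definition blk (Om : finType) (Q : set (set Om)) (w : Om) : set Om :=
  [set w' | exists B, [/\ Q B, B w & B w']].

Definition ccr (Om : finType) (PS : set (set (set Om))) : set (set Om) :=
  [set B | exists w, B = \bigcap_(Q in PS) blk Q w].

Definition join_partitions (Om : finType) (PS : set (set (set Om))) : set (set Om) :=
  <<s ccr PS >>.

(* G-measurability of a function on the finite state space: all level sets *)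
(* belong to G (for a finite Omega this is measurability w.r.t. Borel sets) *)
Definition Gmeas (Om : finType) (V : Type) (G : set (set Om)) (h : Om -> V) : Prop :=
  forall v, G (h @^-1` [set v]).

Definition sigma_atom (Om : finType) (H : set (set Om)) (w : Om) : set Om :=
  [set w' | forall A, H A -> A w -> A w'].

Definition cond_exp (R : realType) (Om : finType) (q : Om -> R)
  (H : set (set Om)) (X : Om -> R) (w : Om) : R :=
  (\sum_(w' : Om) (\1_(sigma_atom H w) w' : R) * X w' * q w') /
  (\sum_(w' : Om) (\1_(sigma_atom H w) w' : R) * q w').

Record economy (R : realType) d (T : measurableType d) (Om : finType)
    (Y : normedModType R) := Economy {
  mu : {measure set T -> \bar R};
  sF : set (set Om);
  Yp : set Y;
  T0 : set T;                   (* atomless part *)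
  T1 : set T;                   (* large agents (atoms) *)
  Pi : T -> set (set Om);       (* information partitions *)
  U  : T -> Om -> Y -> R;       (* state-dependent utilities *)
  a  : T -> Om -> Y;            (* endowments *)
  q  : T -> Om -> R             (* priors *)
}.

Arguments economy : clear implicits.
Arguments economy R {d} T Om Y.
Arguments Economy {R d T Om Y}.
Arguments mu {R d T Om Y}.
Arguments sF {R d T Om Y}.
Arguments Yp {R d T Om Y}.
Arguments T0 {R d T Om Y}.
Arguments T1 {R d T Om Y}.
Arguments Pi {R d T Om Y}.
Arguments U {R d T Om Y}.
Arguments a {R d T Om Y}.
Arguments q {R d T Om Y}.


Definition Finfo (R : realType) d (T : measurableType d) (Om : finType) (Y : normedModType R)
  (E : economy R T Om Y) (t : T) : set (set Om) := <<s Pi E t >>.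

Definition agents_setup (R : realType) d (T : measurableType d) (Om : finType)
  (Y : normedModType R) (E : economy R T Om Y) : Prop :=
  [/\
      (forall N, (mu E).-negligible N -> measurable N),
      (mu E setT < +oo)%E,
      (T0 E `|` T1 E = setT /\ T0 E `&` T1 E = set0),
      (measurable (T0 E) /\
      (forall A, measurable A -> A `<=` T0 E -> (0 < mu E A)%E ->
         exists B, [/\ measurable B, B `<=` A, (0 < mu E B)%E & (mu E B < mu E A)%E]))
    & (* T1 countable union of atoms, each atom being one agent *)
      (countable (T1 E) /\
       (forall t, T1 E t -> measurable [set t] /\ (0 < mu E [set t])%E))].

Definition standing_setup (R : realType) d (T : measurableType d) (Om : finType)
  (Y : completeNormedModType R) (E : economy R T Om Y) : Prop :=
  [/\ sigma_algebra setT (sF E),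
      agents_setup E,
      (positive_cone (Yp E) /\ (Yp E)° !=set0),
      ((forall t, is_partition (Pi E t)) /\
       (forall t, (forall w, 0 < q E t w) /\ \sum_(w : Om) q E t w = 1))
    & 
[/\ (forall t w, Yp E (a E t w)),
          (forall t B w w', Pi E t B -> B w -> B w' -> a E t w = a E t w')
        & (forall w, bochner_integrable (mu E) setT (fun t => a E t w))]].

Definition coalition (R : realType) d (T : measurableType d) (Om : finType) (Y : normedModType R)
  (E : economy R T Om Y) (S : set T) : Prop :=
  measurable S /\ (0 < mu E S)%E.

Definition S_allocation (R : realType) d (T : measurableType d) (Om : finType) (Y : normedModType R)
  (E : economy R T Om Y) (S : set T) (f : T -> Om -> Y) : Prop :=
  [/\ (forall t w, S t -> Yp E (f t w)),
      (forall w, bochner_integrable (mu E) S (fun t => f t w))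
    & {ae mu E, forall t, S t -> Gmeas (sF E) (f t)}].

Definition S_assignment (R : realType) d (T : measurableType d) (Om : finType) (Y : normedModType R)
  (E : economy R T Om Y) (S : set T) (f : T -> Om -> Y) : Prop :=
  (forall t w, S t -> Yp E (f t w)) /\
  (forall w, bochner_integrable (mu E) S (fun t => f t w)).

Definition int_eq (R : realType) d (T : measurableType d) (Y : normedModType R)
  (mu : {measure set T -> \bar R}) (S : set T) (g h : T -> Y) : Prop :=
  exists y, bochner_int mu S g y /\ bochner_int mu S h y.

Definition int_le (R : realType) d (T : measurableType d) (Y : normedModType R)
  (mu : {measure set T -> \bar R}) (Yp : set Y) (S : set T) (g h : T -> Y) : Prop :=
  exists y1 y2, [/\ bochner_int mu S g y1, bochner_int mu S h y2 & yle Yp y1 y2].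

Definition feasible (R : realType) d (T : measurableType d) (Om : finType) (Y : normedModType R)
  (E : economy R T Om Y) (f : T -> Om -> Y) : Prop :=
  S_allocation E setT f /\
  forall w, int_le (mu E) (Yp E) setT (fun t => f t w) (fun t => a E t w).

Definition T_Q (R : realType) d (T : measurableType d) (Om : finType) (Y : normedModType R)
  (E : economy R T Om Y) (Q : set (set Om)) : set T := [set t | Pi E t = Q].

Definition P_S (R : realType) d (T : measurableType d) (Om : finType) (Y : normedModType R)
  (E : economy R T Om Y) (S : set T) : set (set (set Om)) :=
  [set Q | S `&` T_Q E Q !=set0].

Definition comm_system (R : realType) d (T : measurableType d) (Om : finType) (Y : normedModType R)
  (E : economy R T Om Y) (S : set T) (G : T -> set (set Om)) : Prop :=
  [/\ (forall t, S t -> sub_sigma (sF E) (G t)),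
      (forall H, sub_sigma (sF E) H -> measurable [set t | S t /\ G t = H])
    & {ae mu E, forall t, S t ->
         Finfo E t `<=` G t /\ G t `<=` join_partitions (P_S E S)}].

Definition RW_fine_blocked (R : realType) d (T : measurableType d) (Om : finType)
  (Y : normedModType R) (E : economy R T Om Y) (f : T -> Om -> Y) (S : set T) : Prop :=
  exists (g : T -> Om -> Y) (G : T -> set (set Om)) (A : set Om),
  [/\ S_allocation E S g, comm_system E S G,
      (A !=set0 /\ forall t, S t -> G t A),
      (forall w, A w -> int_eq (mu E) S (fun t => g t w) (fun t => a E t w))
    & (forall w, A w -> {ae mu E, forall t, S t ->
          cond_exp (q E t) (G t) (fun w' => U E t w' (f t w')) w <
          cond_exp (q E t) (G t) (fun w' => U E t w' (g t w')) w})].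

Definition RW_fine_core (R : realType) d (T : measurableType d) (Om : finType)
  (Y : normedModType R) (E : economy R T Om Y) (f : T -> Om -> Y) : Prop :=
  feasible E f /\ forall S, coalition E S -> ~ RW_fine_blocked E f S.

Definition ex_post_blocked (R : realType) d (T : measurableType d) (Om : finType)
  (Y : normedModType R) (E : economy R T Om Y) (f : T -> Om -> Y) (S : set T) : Prop :=
  exists (g : T -> Om -> Y) (w0 : Om),
  [/\ S_allocation E S g,
      int_eq (mu E) S (fun t => g t w0) (fun t => a E t w0)
    & {ae mu E, forall t, S t -> U E t w0 (f t w0) < U E t w0 (g t w0)}].

Definition ex_post_core (R : realType) d (T : measurableType d) (Om : finType)
  (Y : normedModType R) (E : economy R T Om Y) (f : T -> Om -> Y) : Prop :=
  feasible E f /\ forall S, coalition E S -> ~ ex_post_blocked E f S.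

Definition A1 (R : realType) d (T : measurableType d) (Om : finType) (Y : normedModType R)
  (E : economy R T Om Y) : Prop :=
  (forall w, measurable_fun setT (fun t => q E t w)) /\
  (forall Q, is_partition Q -> measurable (T_Q E Q)).

Definition A2 (R : realType) d (T : measurableType d) (Om : finType) (Y : normedModType R)
  (E : economy R T Om Y) : Prop :=
  (forall w x, Yp E x -> measurable_fun setT (fun t => U E t w x)) /\
  (forall t w, {within Yp E, continuous (U E t w)}).

Definition A3 (R : realType) d (T : measurableType d) (Om : finType) (Y : normedModType R)
  (E : economy R T Om Y) : Prop :=
  forall t w x y, Yp E x -> ygg0 (Yp E) y -> U E t w x < U E t w (x + y).

Definition A4 (R : realType) d (T : measurableType d) (Om : finType) (Y : normedModType R)
  (E : economy R T Om Y) : Prop :=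
  forall t0 w0 S f, T1 E t0 -> coalition E S -> (0 < mu E (S `&` T1 E))%E ->
    S_assignment E S f ->
    (forall w, int_le (mu E) (Yp E) S (fun t => f t w) (fun t => a E t w)) ->
    forall y, bochner_int (mu E) (S `&` T1 E) (fun t => f t w0) y ->
    let fhat := (fine (mu E (S `&` T1 E)))^-1 *: y in
    (((fine (mu E (S `&` T1 E)))^-1)%:E *
       (\int[mu E]_(t in S `&` T1 E) (U E t0 w0 (f t w0))%:E)%E <=
     (U E t0 w0 fhat)%:E)%E.

Definition A5 (R : realType) d (T : measurableType d) (Om : finType) (Y : normedModType R)
  (E : economy R T Om Y) : Prop :=
  forall t w, ygg0 (Yp E) (a E t w).

Definition A6 (R : realType) d (T : measurableType d) (Om : finType) (Y : normedModType R)
  (E : economy R T Om Y) : Prop :=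
  forall t t', T1 E t -> T1 E t' ->
    [/\ U E t = U E t', a E t = a E t', Pi E t = Pi E t' & q E t = q E t'].

Definition A7 (R : realType) d (T : measurableType d) (Om : finType) (Y : normedModType R)
  (E : economy R T Om Y) : Prop :=
  exists t t', [/\ T1 E t, T1 E t' & t <> t'].

Definition A8 (R : realType) d (T : measurableType d) (Om : finType) (Y : normedModType R)
  (E : economy R T Om Y) : Prop :=
  join_partitions (P_S E setT) = sF E.

Definition A9 (R : realType) d (T : measurableType d) (Om : finType) (Y : normedModType R)
  (E : economy R T Om Y) : Prop :=
  {ae mu E, forall t, forall x, Yp E x -> Gmeas (sF E) (fun w => U E t w x)}.

(* Main.v *)
Require Import Defs.
From HB Require Import structures.
From mathcomp Require Import all_boot all_order all_algebra.
From mathcomp Require Import ring lra.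
From mathcomp Require Import all_classical all_reals all_analysis measurable_realfun.
Set Implicit Arguments. Unset Strict Implicit. Unset Printing Implicit Defensive.
Import Order.TTheory GRing.Theory Num.Theory.
Import numFieldNormedType.Exports.
Local Open Scope classical_set_scope.
Local Open Scope ring_scope.

(** Suppose [g] ex-postly blocks [f] on [S] in state [w0]. Once [S] contains a large
    agent, adjoining one negligible small agent per information partition makes the
    pooled information of the coalition equal to [sF]; sharing all of it and blocking on
    the atom of [sF] at [w0], where endowments are constant, yields an RW-fine objection.
    If [S] consists of small agents only, a large agent is brought in as in Vind's theorem.
    By (A4) some large agent weakly prefers the average [fhat] of [f] over the large agents;
    let [al < 1] be its share of their total mass (A7). Shrinking [g] slightly frees a
    strictly positive amount. By an approximate Lyapunov theorem the small agents contain
    [D], a fraction [1 - al] of the atomless part for the net trades involved. Giving the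
    shrunk [g] to [D `&` S], [f] to the small agents outside [D] and [fhat] to the large
    agent leaves a strictly positive surplus, which is distributed uniformly. *)

(** On an atom of [sF] the endowments and, for almost every agent, the bundles of [f] and the
    utility of a fixed bundle are constant, so conditional expectations given [sF] are ex-post
    utilities. The obstacle is that a communication system is bounded by the pooled partitions of
    the coalition itself. Small agents can be adjoined free of charge because points of the atomless
    part are null; a point of [T1] has positive mass, so the partition of the large agents must
    already be present, and by (A6) one of them supplies it. In Vind's step the share [al] balances
    the books: the net trade of the large agent at [fhat] is exactly [al] times that of all large
    agents at [f], and the small agents outside [D] carry about [al] times the net trade of [T0].
    Together they make about [al] times the aggregate net trade of [f], whose negative lies in the
    cone. Lyapunov's theorem is only approximate in infinite dimension; the error is absorbed
    because the amount freed from [g] is interior to the cone. Weak preference for [f] and [fhat]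
    suffices, as (A3) turns an interior share of the surplus into a strict gain. *)

(** * Simple functions as lists of weighted sets *)

Section SimpleFunctions.
Context {R : realType} {d : measure_display} {T : measurableType d}
  {Y : completeNormedModType R}.

(** The sets of the list may overlap. Concatenation is then addition, and inductions split the
    domain along the first set instead of refining to a partition. *)
Definition simple_val (l : seq (set T * Y)) (t : T) : Y :=
  \sum_(p <- l) (\1_(p.1) t : R) *: p.2.

Definition smeas (l : seq (set T * Y)) : Prop :=
  foldr (fun p P => measurable p.1 /\ P) True l.

Definition sres (B : set T) (l : seq (set T * Y)) :=
  [seq (p.1 `&` B, p.2) | p <- l].

Definition sscale (k : R) (l : seq (set T * Y)) := [seq (p.1, k *: p.2) | p <- l].

Lemma sval_nil t : simple_val [::] t = 0.
Proof. by rewrite /simple_val big_nil. Qed.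

Lemma sval_cons A x l t : simple_val ((A, x) :: l) t = (\1_A t : R) *: x + simple_val l t.
Proof. by rewrite /simple_val big_cons. Qed.

Lemma sval_consT A x l t : A t -> simple_val ((A, x) :: l) t = x + simple_val l t.
Proof. by move=> At; rewrite sval_cons indicE mem_set// scale1r. Qed.

Lemma sval_consF A x l t : ~ A t -> simple_val ((A, x) :: l) t = simple_val l t.
Proof. by move=> At; rewrite sval_cons indicE memNset// scale0r add0r. Qed.

Lemma sval_cat l1 l2 t : simple_val (l1 ++ l2) t = simple_val l1 t + simple_val l2 t.
Proof. by rewrite /simple_val big_cat. Qed.

Lemma sval_scale k l t : simple_val (sscale k l) t = k *: simple_val l t.
Proof.
by rewrite /simple_val big_map scaler_sumr; apply: eq_bigr => p _; rewrite !scalerA mulrC.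
Qed.

Lemma sval_res B l t : simple_val (sres B l) t = (\1_B t : R) *: simple_val l t.
Proof.
rewrite /simple_val big_map scaler_sumr; apply: eq_bigr => p _ /=.
by rewrite indicI scalerA mulrC.
Qed.

Lemma smeas_cat l1 l2 : smeas l1 -> smeas l2 -> smeas (l1 ++ l2).
Proof. by elim: l1 => [//|p l IH] /= [mp ml] m2; split=> //; exact: IH. Qed.

Lemma smeas_scale k l : smeas l -> smeas (sscale k l).
Proof. by elim: l => [//|p l IH] /= [mp /IH]. Qed.

Lemma smeas_res B l : measurable B -> smeas l -> smeas (sres B l).
Proof.
by move=> mB; elim: l => [//|p l IH] /= [mp /IH ml]; split=> //; exact: measurableI.
Qed.

(** The offset [c] collects the vectors of the sets already peeled off. Measurability of [phi] in
    [t] at each fixed [y] is enough, as the second argument is constant on each cell. *)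
Lemma measurable_sval l c S d' (V : measurableType d') (phi : T -> Y -> V) :
  smeas l -> measurable S -> (forall y, measurable_fun setT (phi ^~ y)) ->
  measurable_fun S (fun t => phi t (c + simple_val l t)).
Proof.
move=> ml mS mphi; elim: l c S ml mS => [|[A x] l IH] c S /= ml mS.
  under eq_fun do rewrite sval_nil addr0.
  exact: measurable_funTS.
case: ml => mA ml; rewrite -(setUIDK S A).
apply/measurable_funU; [exact: measurableI|exact: measurableD|split].
  apply: (eq_measurable_fun (fun t => phi t ((c + x) + simple_val l t))).
    by move=> t /[!inE] -[_ At]; rewrite sval_consT// addrA.
  by apply: IH => //; exact: measurableI.
apply: (eq_measurable_fun (fun t => phi t (c + simple_val l t))).
  by move=> t /[!inE] -[_ At]; rewrite sval_consF.
by apply: IH => //; exact: measurableD.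
Qed.

Lemma measurable_norm_sval l c S : smeas l -> measurable S ->
  measurable_fun S (fun t => `|c + simple_val l t|).
Proof.
by move=> ml mS; apply: (measurable_sval c (phi := fun _ y => `|y|)).
Qed.

(* Near-optimal values of [h] on the cells of [l]: the new simple function takes
   its values in [h @` S] and loses only a factor 2 pointwise. *)
Lemma sval_in_range (l : seq (set T * Y)) (h : T -> Y) (c : Y) (S : set T) (eta : R) :
  smeas l -> measurable S -> 0 < eta ->
  exists l', [/\ smeas l', (forall t, ~ S t -> simple_val l' t = 0) &
    forall t, S t -> (exists2 u, S u & simple_val l' t = h u) /\
      `|h t - simple_val l' t| <= 2 * `|h t - (c + simple_val l t)| + eta].
Proof.
move=> ml mS eta0; elim: l c S ml mS => [|[A x] l IH] c S /= ml mS.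
  have [->|/set0P[s0 Ss0]] := eqVneq S set0.
    by exists [::]; split => // t _; rewrite sval_nil.
  pose D := [set `|h t - c| | t in S].
  (* [u] nearly minimises the distance of [h] to the constant [c], so passing through [c] bounds
     [h t - h u] by twice the distance from [h t] to [c], plus [eta]. *)
  have [u Su uP] : exists2 u, S u & forall t, S t -> `|h u - c| <= `|h t - c| + eta.
    have hD : has_inf D.
      by split; [exists `|h s0 - c|; exists s0|exists 0 => _ [t _ <-]].
    have [_ [u Su <-] uP] := inf_adherent eta0 hD.
    exists u => // t St; rewrite (le_trans (ltW uP))// lerD2r.
    by apply: ge_inf; [case: hD|exists t].
  exists [:: (S, h u)]; split => //.
    by move=> t St; rewrite sval_consF// sval_nil.
  move=> t St; rewrite sval_consT// sval_nil !addr0; split; first by exists u.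
  rewrite (_ : h t - h u = (h t - c) - (h u - c)); last by rewrite opprB addrA subrK.
  rewrite (le_trans (ler_normB _ _))// mulr_natl mulr2n -addrA lerD2l.
  exact: uP.
case: ml => mA ml.
have [l1 [ml1 l1out l1P]] := IH (c + x) _ ml (measurableI _ _ mS mA).
have [l2 [ml2 l2out l2P]] := IH c _ ml (measurableD mS mA).
exists (l1 ++ l2); split; first exact: smeas_cat.
  by move=> t nSt; rewrite sval_cat l1out ?l2out ?addr0// => -[].
move=> t St; have [At|nAt] := pselect (A t).
  rewrite sval_cat (l2out t) ?addr0; last by case.
  have [[u [Su _] ut] nt] := l1P t (conj St At).
  by split; [exists u|rewrite sval_consT// addrA].
rewrite sval_cat (l1out t) ?add0r; last by case.
have [[u [Su _] ut] nt] := l2P t (conj St nAt).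
by split; [exists u|rewrite sval_consF].
Qed.

End SimpleFunctions.

(** * Integrals of simple functions for a finite measure *)

Section SimpleIntegral.
Context {R : realType} {d : measure_display} {T : measurableType d}
  {Y : completeNormedModType R}.
Variable mu : {measure set T -> \bar R}.
Hypothesis mufin : (mu setT < +oo)%E.
Implicit Types (l : seq (set T * Y)) (S A B : set T).

Definition rmeas (A : set T) : R := fine (mu A).

Definition sint (S : set T) (l : seq (set T * Y)) : Y :=
  \sum_(p <- l) rmeas (p.1 `&` S) *: p.2.

Lemma mu_fin A : measurable A -> mu A \is a fin_num.
Proof.
move=> mA; rewrite ge0_fin_numE//; apply: le_lt_trans mufin.
by apply: le_measure; rewrite ?inE.
Qed.

Lemma rmeasE A : measurable A -> mu A = (rmeas A)%:E.
Proof. by move=> mA; rewrite fineK// mu_fin. Qed.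

Lemma rmeas_ge0 A : 0 <= rmeas A.
Proof. by rewrite fine_ge0. Qed.

Lemma rmeasU A B : measurable A -> measurable B -> A `&` B = set0 ->
  rmeas (A `|` B) = rmeas A + rmeas B.
Proof.
by move=> mA mB AB; rewrite /rmeas measureU// fineD// mu_fin.
Qed.

Lemma rmeas_split S A : measurable S -> measurable A ->
  rmeas S = rmeas (S `&` A) + rmeas (S `\` A).
Proof.
move=> mS mA; rewrite -rmeasU; first by rewrite setUIDK.
- exact: measurableI.
- exact: measurableD.
- by rewrite setDE setIACA setICr setI0.
Qed.

Lemma le_rmeas A B : measurable A -> measurable B -> A `<=` B -> rmeas A <= rmeas B.
Proof. by move=> mA mB AB; rewrite fine_le ?mu_fin// le_measure ?inE. Qed.

Lemma sint_nil S : sint S [::] = 0.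
Proof. by rewrite /sint big_nil. Qed.

Lemma sint_cons S A x l : sint S ((A, x) :: l) = rmeas (A `&` S) *: x + sint S l.
Proof. by rewrite /sint big_cons. Qed.

Lemma sint_cat S l1 l2 : sint S (l1 ++ l2) = sint S l1 + sint S l2.
Proof. by rewrite /sint big_cat. Qed.

Lemma sint_scale S k l : sint S (sscale k l) = k *: sint S l.
Proof.
by rewrite /sint big_map scaler_sumr; apply: eq_bigr => p _; rewrite !scalerA mulrC.
Qed.

Lemma sint_res S B l : sint S (sres B l) = sint (B `&` S) l.
Proof. by rewrite /sint big_map; apply: eq_bigr => p _ /=; rewrite setIA. Qed.

Lemma sint_split S A l : smeas l -> measurable S -> measurable A ->
  sint S l = sint (S `&` A) l + sint (S `\` A) l.
Proof.
move=> ml mS mA; elim: l ml => [|[B x] l IH] /=.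
  by rewrite !sint_nil addr0.
case=> mB /IH {}IH; rewrite !sint_cons IH addrACA -scalerDl; congr (_ *: _ + _).
rewrite (rmeas_split (S := B `&` S) _ mA); last exact: measurableI.
by rewrite setIA setIDA.
Qed.

Lemma integral_norm_split (h : T -> Y) S A :
  measurable_fun S (fun t => `|h t|) -> measurable S -> measurable A ->
  (\int[mu]_(t in S) `|h t|%:E = \int[mu]_(t in S `&` A) `|h t|%:E +
    \int[mu]_(t in S `\` A) `|h t|%:E)%E.
Proof.
move=> mh mS mA; rewrite -{1}(setUIDK S A) ge0_integral_setU ?setUIDK//.
- exact: measurableI.
- exact: measurableD.
- exact/measurable_EFinP.
- by apply/disj_setPS => t [[_ At] []].
Qed.

(** A termwise triangle inequality would lose too much, because overlapping vectors may cancel; the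
    offset [c] carries the accumulated value of a cell through the induction. *)
Lemma sint_norm_gen l S c : smeas l -> measurable S ->
  (`|rmeas S *: c + sint S l|%:E <= \int[mu]_(t in S) `|c + simple_val l t|%:E)%E.
Proof.
elim: l c S => [|[A x] l IH] c S /= ml mS.
  rewrite sint_nil addr0; under eq_integral do rewrite sval_nil addr0.
  by rewrite integral_cst// normrZ ger0_norm ?rmeas_ge0// rmeasE// -EFinM mulrC.
case: ml => mA ml.
have mSA := measurableI _ _ mS mA; have mSDA := measurableD mS mA.
rewrite (@integral_norm_split _ S A)//; last first.
  by apply: measurable_norm_sval => //=; split.
have -> : rmeas S *: c + sint S ((A, x) :: l) =
    (rmeas (S `&` A) *: (c + x) + sint (S `&` A) l) +
    (rmeas (S `\` A) *: c + sint (S `\` A) l).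
  rewrite sint_cons (sint_split ml mS mA) (rmeas_split mS mA) (setIC A S).
  rewrite scalerDl scalerDr; set a := _ *: c; set b := _ *: c; set e := _ *: x.
  by rewrite [RHS]addrACA !addrA (addrAC a b).
set u := _ + sint (S `&` A) l; set v := _ + sint (S `\` A) l.
apply: (@le_trans _ _ (`|u|%:E + `|v|%:E)%E); first by rewrite -EFinD lee_fin ler_normD.
apply: leeD.
  apply: (le_trans (IH (c + x) _ ml mSA)); rewrite le_eqVlt; apply/orP; left.
  by apply/eqP/eq_integral => t /[!inE] -[_ At]; rewrite sval_consT// addrA.
apply: (le_trans (IH c _ ml mSDA)); rewrite le_eqVlt; apply/orP; left.
by apply/eqP/eq_integral => t /[!inE] -[_ At]; rewrite sval_consF.
Qed.

Lemma sint_norm l S : smeas l -> measurable S ->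
  (`|sint S l|%:E <= \int[mu]_(t in S) `|simple_val l t|%:E)%E.
Proof.
move=> ml mS; have := sint_norm_gen 0 ml mS.
by rewrite scaler0 add0r; under eq_integral do rewrite add0r.
Qed.

Lemma integral_norm_sval_lty l S : smeas l -> measurable S ->
  (\int[mu]_(t in S) `|simple_val l t|%:E < +oo)%E.
Proof.
move=> ml mS; pose M := \sum_(p <- l) `|p.2|.
apply: (@le_lt_trans _ _ (\int[mu]_(t in S) (cst M%:E t))%E).
  apply: ge0_le_integral => //.
  - apply/measurable_EFinP; have := measurable_norm_sval 0 ml mS.
    by under eq_fun do rewrite add0r.
  - move=> t _; rewrite lee_fin (le_trans (ler_norm_sum _ _ _))// ler_sum// => p _.
    by rewrite normrZ ler_piMl// indicE; case: (_ \in _); rewrite ?normr1 ?normr0.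
by rewrite integral_cst// rmeasE// -EFinM ltry.
Qed.

End SimpleIntegral.

(** * L1-approximating sequences and the Bochner integral *)

Section Bochner.
Context {R : realType} {d : measure_display} {T : measurableType d}
  {Y : completeNormedModType R}.
Variable mu : {measure set T -> \bar R}.
Hypothesis mufin : (mu setT < +oo)%E.
Hypothesis cmu : measure_is_complete mu.
Implicit Types (S A B : set T) (f g h : T -> Y) (y z : Y).

Lemma negligible_measurable_fun d' (V : measurableType d') (N : set T) (g : T -> V) :
  mu.-negligible N -> measurable_fun N g.
Proof.
move=> Nn _ B mB; apply: cmu; apply: negligibleS Nn; exact: subIsetl.
Qed.

(** Completeness of [mu] makes every function measurable on the exceptional null set, so the limit
    has to be controlled only off that set. *)
Lemma measurable_fun_ae_cvg S (h : nat -> T -> R) (g : T -> R) : measurable S ->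
  (forall n, measurable_fun S (h n)) ->
  {ae mu, forall t, S t -> h n t @[n --> \oo] --> g t} -> measurable_fun S g.
Proof.
move=> mS mh [N [mN N0 badN]]; rewrite -(setUIDK S N).
apply/measurable_funU; [exact: measurableI|exact: measurableD|split].
  by apply: negligible_measurable_fun; exists N; split => //; exact: subIsetr.
apply: (measurable_realfun.measurable_fun_cvg (h := h)).
  by move=> n; apply: measurable_funS (mh n) => //; exact: subDsetl.
move=> t [St Nt]; apply: contrapT => ht; apply: Nt; apply: badN => /=.
by move/(_ St).
Qed.

Lemma le_integral_normD S f g h : measurable S ->
  measurable_fun S (fun t => `|f t|) -> measurable_fun S (fun t => `|g t|) ->
  measurable_fun S (fun t => `|h t|) ->
  (forall t, S t -> `|f t| <= `|g t| + `|h t|) ->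
  (\int[mu]_(t in S) `|f t|%:E <=
   \int[mu]_(t in S) `|g t|%:E + \int[mu]_(t in S) `|h t|%:E)%E.
Proof.
move=> mS /measurable_EFinP mf /measurable_EFinP mg /measurable_EFinP mh fgh.
rewrite -ge0_integralD//; apply: ge0_le_integral => //.
exact: emeasurable_funD.
Qed.

Lemma cvg0_near_lt (e : nat -> \bar R) (eps : R) :
  e n @[n --> \oo] --> 0%E -> 0 < eps -> \forall n \near \oo, (e n < eps%:E)%E.
Proof.
move=> e0 eps0; have := e0 [set x | x < eps%:E]%E; apply.
by apply: (@open_nbhs_nbhs _ 0%E); split; [exact: open_ereal_lt_ereal|rewrite /= lte_fin].
Qed.

Definition bapprox S f (l : nat -> seq (set T * Y)) := [/\ forall n, smeas (l n),
  {ae mu, forall t, S t -> simple_val (l n) t @[n --> \oo] --> f t} &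
  (\int[mu]_(t in S) `|f t - simple_val (l n) t|%:E)%E @[n --> \oo] --> 0%E].

Lemma bochner_intP S f y : bochner_int mu S f y <->
  exists2 l, bapprox S f l & sint mu S (l n) @[n --> \oo] --> y.
Proof.
split.
  move=> [k [A [c [mA Hae HL Hy]]]].
  pose l n := [seq (A n i, c n i) | i <- iota 0 (k n)].
  have svalE n t : simple_val (l n) t = \sum_(i < k n) (\1_(A n i) t : R) *: c n i.
    by rewrite /simple_val big_map -(big_mkord xpredT (fun i => (\1_(A n i) t : R) *: c n i))
      /index_iota subn0.
  have sintE n : sint mu S (l n) = \sum_(i < k n) fine (mu (A n i `&` S)) *: c n i.
    by rewrite /sint big_map
      -(big_mkord xpredT (fun i => fine (mu (A n i `&` S)) *: c n i)) /index_iota subn0.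
  exists l; last by under eq_fun do rewrite sintE.
  split; first by move=> n; rewrite /l; elim: (iota _ _) => //= i s IH; split.
    by apply: filterS Hae => t Ht /Ht; under eq_fun do rewrite -svalE.
  by under eq_fun do under eq_integral do rewrite svalE.
move=> [l [ml Hae HL] Hy].
(* The default [set0] keeps [A n i] measurable for indices beyond the end of the list. *)
pose A n i := (nth (set0, 0) (l n) i).1; pose c n i := (nth (set0, 0) (l n) i).2.
have svalE n t : \sum_(i < size (l n)) (\1_(A n i) t : R) *: c n i = simple_val (l n) t.
  by rewrite /simple_val (big_nth (set0, 0)) big_mkord.
have sintE n : \sum_(i < size (l n)) fine (mu (A n i `&` S)) *: c n i = sint mu S (l n).
  by rewrite /sint (big_nth (set0, 0)) big_mkord.
exists (fun n => size (l n)), A, c; split.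
- move=> n; rewrite /A; elim: (l n) (ml n) => [|p s IH] /= h i;
    first by rewrite nth_nil; exact: measurable0.
  by case: h => mp /IH ms; case: i => //=.
- by apply: filterS Hae => t Ht /Ht; under eq_fun do rewrite -svalE.
- by under eq_fun do under eq_integral do rewrite svalE.
- by under eq_fun do rewrite sintE.
Qed.

Lemma measurable_bapprox S f l l' : measurable S -> bapprox S f l -> smeas l' ->
  measurable_fun S (fun t => `|f t - simple_val l' t|).
Proof.
move=> mS [ml Hae _] ml'.
apply: (@measurable_fun_ae_cvg _ (fun n t => `|simple_val (l n) t - simple_val l' t|)) => //.
  move=> n; have := measurable_norm_sval 0 (smeas_cat (ml n) (smeas_scale (- 1) ml')) mS.
  by under eq_fun do rewrite add0r sval_cat sval_scale scaleN1r.
apply: filterS Hae => t Ht St; apply: cvg_norm; apply: cvgB; [exact: Ht|exact: cvg_cst].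
Qed.

Lemma measurable_norm_bapprox S f l : measurable S -> bapprox S f l ->
  measurable_fun S (fun t => `|f t|).
Proof.
move=> mS bl; have := measurable_bapprox mS bl (I : smeas [::]).
by under eq_fun do rewrite sval_nil subr0.
Qed.

Lemma bapprox_sub S B f l : measurable S -> measurable B -> B `<=` S ->
  bapprox S f l -> bapprox B f l.
Proof.
move=> mS mB BS bl; have [ml Hae HL] := bl; split => //.
  by apply: filterS Hae => t Ht /BS /Ht.
apply: (squeeze_cvge _ (cvg_cst 0%E) HL); apply: nearW => n; apply/andP; split.
  by apply: integral_ge0.
apply: ge0_subset_integral => //; apply/measurable_EFinP.
exact: measurable_bapprox bl _.
Qed.

(** Completeness of [Y] enters here: the integrals are Cauchy because L1 distance bounds their
    differences. This supplies the value of the integral over any smaller set. *)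
Lemma sint_bapprox_cvg S f l : measurable S -> bapprox S f l ->
  cvg (sint mu S (l n) @[n --> \oo]).
Proof.
move=> mS bl; have [ml _ HL] := bl.
apply: cauchy_cvg; apply: cauchy_exP => eps eps0.
have /cvg0_near_lt/(_ (divr_gt0 eps0 (@ltr0n R 2)))-[N _ HN] := HL.
exists (sint mu S (l N)); exists N => // n /= Nn.
rewrite -ball_normE /ball_/=.
have mm := smeas_cat (ml N) (smeas_scale (- 1) (ml n)).
have -> : sint mu S (l N) - sint mu S (l n) = sint mu S (l N ++ sscale (- 1) (l n)).
  by rewrite sint_cat sint_scale scaleN1r.
rewrite -lte_fin; apply: (le_lt_trans (sint_norm mufin mm mS)).
apply: (@le_lt_trans _ _ (\int[mu]_(t in S) `|f t - simple_val (l N) t|%:E +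
                          \int[mu]_(t in S) `|f t - simple_val (l n) t|%:E)%E).
  apply: le_integral_normD => //.
  - by have := measurable_norm_sval 0 mm mS; under eq_fun do rewrite add0r.
  - exact: measurable_bapprox bl _.
  - exact: measurable_bapprox bl _.
  - move=> t St; rewrite sval_cat sval_scale scaleN1r.
    by rewrite (distrC (f t) (simple_val (l N) t)) -(subrKA (f t)) ler_normD.
by rewrite [eps]splitr EFinD lteD ?HN//=.
Qed.

End Bochner.

(** * Linearity, uniqueness and additivity of the Bochner integral *)

Section BochnerTheory.
Context {R : realType} {d : measure_display} {T : measurableType d}
  {Y : completeNormedModType R}.
Variable mu : {measure set T -> \bar R}.
Hypothesis mufin : (mu setT < +oo)%E.
Hypothesis cmu : measure_is_complete mu.
Implicit Types (S A B : set T) (f g h : T -> Y) (y z : Y).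

Lemma bochner_int_eq S f g y : (forall t, S t -> f t = g t) ->
  bochner_int mu S f y -> bochner_int mu S g y.
Proof.
move=> fg /bochner_intP[l [ml Hae HL] Hy]; apply/bochner_intP; exists l => //.
split=> //; first by apply: filterS Hae => t Ht St; rewrite -fg//; exact: Ht.
apply: cvg_trans HL; apply: near_eq_cvg; apply: nearW => n.
by apply: eq_integral => t /[!inE] St; rewrite fg.
Qed.

Lemma measurable_norm_bochner S f y : measurable S -> bochner_int mu S f y ->
  measurable_fun S (fun t => `|f t|).
Proof. by move=> mS /bochner_intP[l bl _]; exact: measurable_norm_bapprox bl. Qed.

Lemma bapproxD S f g l l' : measurable S -> bapprox mu S f l -> bapprox mu S g l' ->
  bapprox mu S (fun t => f t + g t) (fun n => l n ++ l' n).
Proof.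
move=> mS bl bl'; have [ml Hae HL] := bl; have [ml' Hae' HL'] := bl'.
have Hae2 : {ae mu, forall t, S t ->
    simple_val (l n ++ l' n) t @[n --> \oo] --> f t + g t}.
  apply: filterS2 Hae Hae' => t Ht Ht' St.
  by under eq_fun do rewrite sval_cat; apply: cvgD; [exact: Ht|exact: Ht'].
have ml2 n : smeas (l n ++ l' n) by exact: smeas_cat.
split => //.
have H0 : (\int[mu]_(t in S) `|f t - simple_val (l n) t|%:E +
    \int[mu]_(t in S) `|g t - simple_val (l' n) t|%:E)%E @[n --> \oo] --> 0%E.
  by rewrite -[0%E]adde0; apply: cvgeD.
apply: (squeeze_cvge _ (cvg_cst 0%E) H0); apply: nearW => n; apply/andP; split.
  by apply: integral_ge0.
apply: le_integral_normD => //.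
- apply: (@measurable_fun_ae_cvg _ _ _ _ cmu _
    (fun m t => `|simple_val (l m ++ l' m) t - simple_val (l n ++ l' n) t|)) => //.
    move=> m; have := measurable_norm_sval 0
      (smeas_cat (ml2 m) (smeas_scale (- 1) (ml2 n))) mS.
    by under eq_fun do rewrite add0r sval_cat sval_scale scaleN1r.
  apply: filterS Hae2 => t Ht St.
  by apply: cvg_norm; apply: cvgB; [exact: Ht|exact: cvg_cst].
- exact: measurable_bapprox bl _.
- exact: measurable_bapprox bl' _.
- by move=> t St; rewrite sval_cat opprD addrACA ler_normD.
Qed.

Lemma bochner_intD S f g y z : measurable S -> bochner_int mu S f y ->
  bochner_int mu S g z -> bochner_int mu S (fun t => f t + g t) (y + z).
Proof.
move=> mS /bochner_intP[l bl Hl] /bochner_intP[l' bl' Hl']; apply/bochner_intP.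
exists (fun n => l n ++ l' n); first exact: bapproxD.
by under eq_fun do rewrite sint_cat; exact: cvgD.
Qed.

Lemma bochner_intZ S f y k : measurable S -> bochner_int mu S f y ->
  bochner_int mu S (fun t => k *: f t) (k *: y).
Proof.
move=> mS /bochner_intP[l bl Hl]; have [ml Hae HL] := bl; apply/bochner_intP.
exists (fun n => sscale k (l n)); last first.
  by under eq_fun do rewrite sint_scale; apply: cvgZ; first exact: cvg_cst.
split; first by move=> n; exact: smeas_scale.
  apply: filterS Hae => t Ht St; under eq_fun do rewrite sval_scale.
  by apply: cvgZ; [exact: cvg_cst|exact: Ht].
have -> : (fun n => (\int[mu]_(t in S) `|k *: f t - simple_val (sscale k (l n)) t|%:E)%E) =
    (fun n => (`|k|%:E * \int[mu]_(t in S) `|f t - simple_val (l n) t|%:E)%E).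
  apply: funext => n; rewrite -ge0_integralZl//; last first.
    by apply/measurable_EFinP; exact: measurable_bapprox bl _.
  by apply: eq_integral => t _; rewrite sval_scale -scalerBr normrZ EFinM.
by rewrite -(mule0 `|k|%:E); apply: cvgeZl.
Qed.

Lemma bochner_intB S f g y z : measurable S -> bochner_int mu S f y ->
  bochner_int mu S g z -> bochner_int mu S (fun t => f t - g t) (y - z).
Proof.
move=> mS Hf /(bochner_intZ (- 1) mS) Hg; have := bochner_intD mS Hf Hg.
by rewrite scaleN1r; apply: bochner_int_eq => t _; rewrite scaleN1r.
Qed.

Lemma bochner_int_sval S (l : seq (set T * Y)) : measurable S -> smeas l ->
  bochner_int mu S (simple_val l) (sint mu S l).
Proof.
move=> mS ml; apply/bochner_intP; exists (fun=> l); last exact: cvg_cst.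
split => //; first by apply: aeW => t _; exact: cvg_cst.
under eq_fun do under eq_integral do rewrite subrr normr0.
by under eq_fun do rewrite integral0; exact: cvg_cst.
Qed.

Lemma bochner_int_cst S (c : Y) : measurable S ->
  bochner_int mu S (cst c) (rmeas mu S *: c).
Proof.
move=> mS; have /= := bochner_int_sval (l := [:: (setT, c)]) mS (conj measurableT I).
rewrite sint_cons sint_nil addr0 setTI; apply: bochner_int_eq => t _.
by rewrite sval_consT// sval_nil addr0.
Qed.

Lemma bochner_int_norm S f y : measurable S -> bochner_int mu S f y ->
  (`|y|%:E <= \int[mu]_(t in S) `|f t|%:E)%E.
Proof.
move=> mS /bochner_intP[l bl Hl]; have [ml Hae HL] := bl.
apply/lee_addgt0Pr => _/posnumP[e].
have e20 : 0 < e%:num / 2 by [].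
have h1 := cvg0_near_lt HL e20.
have h2 : \forall n \near \oo, `|y - sint mu S (l n)| < e%:num / 2.
  by move/cvgrPdist_lt: Hl; exact.
have [n [/= {}h1 {}h2]] := filter_ex (filterI h1 h2).
apply: (@le_trans _ _ (`|sint mu S (l n)|%:E + (e%:num / 2)%:E)%E).
  rewrite -EFinD lee_fin -lerBlDl (le_trans _ (ltW h2))//.
  exact: lerB_dist.
rewrite [in leRHS](splitr e%:num) EFinD addeA leeD2r//.
apply: (le_trans (sint_norm mufin (ml n) mS)).
apply: (@le_trans _ _ (\int[mu]_(t in S) `|f t|%:E +
  \int[mu]_(t in S) `|f t - simple_val (l n) t|%:E)%E); last by rewrite leeD2l// ltW.
apply: le_integral_normD => //.
- by have := measurable_norm_sval 0 (ml n) mS; under eq_fun do rewrite add0r.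
- exact: measurable_norm_bapprox bl.
- exact: measurable_bapprox bl _.
- by move=> t _; rewrite -lerBlDl distrC lerB_dist.
Qed.

(** The definition only asks for some approximating sequence; the norm bound applied to [f - f]
    removes the dependence on it. *)
Lemma bochner_int_uniq S f y z : measurable S ->
  bochner_int mu S f y -> bochner_int mu S f z -> y = z.
Proof.
move=> mS Hy Hz; have := bochner_int_norm mS (bochner_intB mS Hy Hz).
under eq_integral do rewrite subrr normr0.
by rewrite integral0 lee_fin normr_le0 subr_eq0 => /eqP.
Qed.

Lemma bochner_int_sub_sint S f y l : measurable S -> bochner_int mu S f y -> smeas l ->
  (`|y - sint mu S l|%:E <= \int[mu]_(t in S) `|f t - simple_val l t|%:E)%E.
Proof.
move=> mS Hf ml.
exact: bochner_int_norm (bochner_intB mS Hf (bochner_int_sval mS ml)).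
Qed.

Lemma bochner_integral_norm_lty S f y : measurable S -> bochner_int mu S f y ->
  (\int[mu]_(t in S) `|f t|%:E < +oo)%E.
Proof.
move=> mS /bochner_intP[l bl Hl]; have [ml Hae HL] := bl.
have [N _ HN] := cvg0_near_lt HL ltr01.
apply: (@le_lt_trans _ _ (\int[mu]_(t in S) `|simple_val (l N) t|%:E +
  \int[mu]_(t in S) `|f t - simple_val (l N) t|%:E)%E).
  apply: le_integral_normD => //.
  - exact: measurable_norm_bapprox bl.
  - by have := measurable_norm_sval 0 (ml N) mS; under eq_fun do rewrite add0r.
  - exact: measurable_bapprox bl _.
  - by move=> t _; rewrite -lerBlDl lerB_dist.
apply: lte_add_pinfty; first exact: integral_norm_sval_lty.
by apply: (lt_trans (HN N _)) => //=; rewrite ltry.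
Qed.

Lemma bochner_integrable_sub S B f : measurable S -> measurable B -> B `<=` S ->
  bochner_integrable mu S f -> bochner_integrable mu B f.
Proof.
move=> mS mB BS [y /bochner_intP[l bl _]].
have bl' := bapprox_sub cmu mS mB BS bl.
exists (lim (sint mu B (l n) @[n --> \oo])); apply/bochner_intP; exists l => //.
exact: (sint_bapprox_cvg mufin cmu mB bl').
Qed.

Lemma bochner_int_setU A B f y z : measurable A -> measurable B -> A `&` B = set0 ->
  bochner_int mu A f y -> bochner_int mu B f z -> bochner_int mu (A `|` B) f (y + z).
Proof.
move=> mA mB AB /bochner_intP[l bl Hl] /bochner_intP[l' bl' Hl'].
have [ml Hae HL] := bl; have [ml' Hae' HL'] := bl'.
pose k n := sres A (l n) ++ sres B (l' n).
have kA n t : A t -> simple_val (k n) t = simple_val (l n) t.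
  move=> At; rewrite sval_cat !sval_res !indicE mem_set// memNset ?scale0r.
    by rewrite addr0 scale1r.
  by move=> Bt; have : (A `&` B) t by []; rewrite AB.
have kB n t : B t -> simple_val (k n) t = simple_val (l' n) t.
  move=> Bt; rewrite sval_cat !sval_res !indicE (@memNset _ A).
    by rewrite mem_set// scale0r add0r scale1r.
  by move=> At; have : (A `&` B) t by []; rewrite AB.
have mk n : smeas (k n) by apply: smeas_cat; exact: smeas_res.
have kae : {ae mu, forall t, (A `|` B) t -> simple_val (k n) t @[n --> \oo] --> f t}.
  apply: filterS2 Hae Hae' => t Ht Ht' [At|Bt].
    by under eq_fun do rewrite kA//; exact: Ht.
  by under eq_fun do rewrite kB//; exact: Ht'.
apply/bochner_intP; exists k; last first.
  under eq_fun do rewrite sint_cat !sint_res.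
  rewrite [A `&` _]setIC setUK [B `&` _]setIC (setUC A) setUK.
  exact: cvgD.
split => //.
have -> : (fun n => (\int[mu]_(t in A `|` B) `|f t - simple_val (k n) t|%:E)%E) =
    (fun n => (\int[mu]_(t in A) `|f t - simple_val (l n) t|%:E +
               \int[mu]_(t in B) `|f t - simple_val (l' n) t|%:E)%E).
  apply: funext => n; rewrite ge0_integral_setU//.
  - congr (_ + _)%E; apply: eq_integral => t /[!inE] ht; [by rewrite kA|by rewrite kB].
  - apply/measurable_EFinP; apply/measurable_funU => //; split.
      apply: (eq_measurable_fun (fun t => `|f t - simple_val (l n) t|)).
        by move=> t /[!inE] At; rewrite kA.
      exact: measurable_bapprox bl _.
    apply: (eq_measurable_fun (fun t => `|f t - simple_val (l' n) t|)).
      by move=> t /[!inE] At; rewrite kB.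
    exact: measurable_bapprox bl' _.
  - by apply/disj_setPS; rewrite AB.
by rewrite -[0%E]adde0; apply: cvgeD.
Qed.

Lemma bochner_int_null N f : mu.-negligible N -> bochner_int mu N f 0.
Proof.
move=> Nn; have mN : measurable N by exact: cmu.
have N0 : mu N = 0%E by exact/negligibleP.
apply/bochner_intP; exists (fun=> [::]); last first.
  by under eq_fun do rewrite sint_nil; exact: cvg_cst.
split => //.
  by apply: negligibleS Nn => t /= /not_implyP[].
rewrite (_ : (fun _ => _) = fun=> 0%E); first exact: cvg_cst.
apply: funext => _; apply: null_set_integral => //.
by apply/measurable_EFinP; exact: (negligible_measurable_fun cmu).
Qed.

Lemma bochner_int_split S A f y : measurable S -> measurable A -> A `<=` S ->
  bochner_int mu S f y -> exists y1 y2,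
  [/\ bochner_int mu A f y1, bochner_int mu (S `\` A) f y2 & y = y1 + y2].
Proof.
move=> mS mA AS Hf; have mD := measurableD mS mA.
have [y1 H1] : bochner_integrable mu A f.
  by apply: (bochner_integrable_sub mS) => //; exists y.
have [y2 H2] : bochner_integrable mu (S `\` A) f.
  by apply: (bochner_integrable_sub mS) => //; exists y.
exists y1, y2; split=> //; apply: (bochner_int_uniq mS Hf).
by have := bochner_int_setU mA mD (setDIK _ _) H1 H2; rewrite setDUK.
Qed.

End BochnerTheory.

(** * Integrals of cone-valued functions *)

Section BochnerCone.
Context {R : realType} {d : measure_display} {T : measurableType d}
  {Y : completeNormedModType R}.
Variable mu : {measure set T -> \bar R}.
Hypothesis mufin : (mu setT < +oo)%E.
Hypothesis cmu : measure_is_complete mu.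
Implicit Types (S A B : set T) (f g h : T -> Y) (y z : Y).

(** Approximants whose values are values of [f] inherit its pointwise constraints. This keeps them
    in the cone, both for integrating cone-valued functions and for utilities that are continuous
    only there. *)
Lemma bapprox_in_range S f l : measurable S -> bapprox mu S f l ->
  exists2 k, bapprox mu S f k &
    forall n t, S t -> exists2 u, S u & simple_val (k n) t = f u.
Proof.
move=> mS bl; have [ml Hae HL] := bl.
have /choice[k kP] : forall n, exists k : seq (set T * Y), [/\ smeas k,
    (forall t, ~ S t -> simple_val k t = 0) & forall t, S t ->
    (exists2 u, S u & simple_val k t = f u) /\
    `|f t - simple_val k t| <= 2 * `|f t - simple_val (l n) t| + n.+1%:R^-1].
  (* The tolerance vanishes uniformly, which costs in L1 at most [n.+1%:R^-1] times the finite mass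
     of [S]. *)
  move=> n; have n0 : 0 < n.+1%:R^-1 :> R by rewrite invr_gt0.
  have [k [mk kout kP]] := sval_in_range f 0 (ml n) mS n0.
  by exists k; split => // t St; have [] := kP t St; rewrite add0r.
have mk n : smeas (k n) by case: (kP n).
have kf n t : S t -> `|f t - simple_val (k n) t| <= 2 * `|f t - simple_val (l n) t| + n.+1%:R^-1.
  by move=> St; case: (kP n) => _ _ /(_ _ St)[].
exists k; last by move=> n t St; case: (kP n) => _ _ /(_ _ St)[].
have inv0 : (n.+1%:R^-1 : R) @[n --> \oo] --> (0 : R) by exact: cvg_harmonic.
have kae : {ae mu, forall t, S t -> simple_val (k n) t @[n --> \oo] --> f t}.
  apply: filterS Hae => t /[swap] St /(_ St) /cvgrPdist_lt Ht.
  apply/cvgrPdist_le => e e0; move/cvgrPdist_lt : inv0 => inv0.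
  apply: filterS2 (Ht _ (divr_gt0 e0 (@ltr0n R 4))) (inv0 _ (divr_gt0 e0 (@ltr0n R 2))).
  move=> n h1 h2; rewrite (le_trans (kf n t St))//.
  rewrite sub0r normrN ger0_norm ?invr_ge0// in h2.
  by have : forall a b c : R, a < c / 4 -> b < c / 2 -> 2 * a + b <= c; [move=> *; lra|exact].
split => //.
have H0 : (2%:E * \int[mu]_(t in S) `|f t - simple_val (l n) t|%:E +
    (n.+1%:R^-1)%:E * mu S)%E @[n --> \oo] --> 0%E.
  rewrite [X in _ --> X](_ : _ = (2%:E * 0 + 0%:E * mu S)%E); last first.
    by rewrite mule0 mul0e adde0.
  apply: cvgeD; first by rewrite mule0 mul0e.
    exact: cvgeZl.
  by apply: cvgeZr; [exact: mu_fin|apply/fine_cvgP; split; [exact: nearW|exact: inv0]].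
apply: (squeeze_cvge _ (cvg_cst 0%E) H0); apply: nearW => n; apply/andP; split.
  by apply: integral_ge0.
rewrite -integral_cst// -ge0_integralZl//; last first.
  by apply/measurable_EFinP; exact: measurable_bapprox bl _.
rewrite -ge0_integralD//; last 2 first.
- apply: measurable_funeM; apply/measurable_EFinP.
  exact: measurable_bapprox bl _.
- by move=> t _; rewrite lee_fin invr_ge0.
apply: ge0_le_integral => //.
- by apply/measurable_EFinP; exact: measurable_bapprox bl _.
- apply: emeasurable_funD; last exact: measurable_cst.
  apply: measurable_funeM; apply/measurable_EFinP.
  exact: measurable_bapprox bl _.
- by move=> t St; rewrite -EFinM -EFinD lee_fin kf.
Qed.

Lemma sint_closed_cone (P : set Y) S l : positive_cone P -> measurable S -> smeas l ->
  (forall t, S t -> P (simple_val l t)) -> P (sint mu S l).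
Proof.
move=> [P0 PD PZ _ _] mS ml lP.
(* Single vectors of [l] may lie outside [P]; only their sums at points of [S] are known to be in
   it, hence the induction with an offset. *)
suff gen c : (forall t, S t -> P (c + simple_val l t)) -> P (rmeas mu S *: c + sint mu S l).
  by have := gen 0; rewrite scaler0 add0r; apply => t St; rewrite add0r; exact: lP.
elim: l c S mS ml {lP} => [|[A x] l IH] c S mS /= ml Pc.
  rewrite sint_nil addr0; have [->|/set0P[t St]] := eqVneq S set0.
    by rewrite /rmeas measure0 scale0r.
  by apply: PZ; [exact: rmeas_ge0|move: (Pc t St); rewrite sval_nil addr0].
case: ml => mA ml; rewrite sint_cons setIC.
rewrite (sint_split mufin ml mS mA) (rmeas_split mufin mS mA) scalerDl.
have mSA := measurableI _ _ mS mA; have mSDA := measurableD mS mA.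
have h1 : P (rmeas mu (S `&` A) *: (c + x) + sint mu (S `&` A) l).
  by apply: IH => // t [St At]; have := Pc t St; rewrite sval_consT// addrA.
have h2 : P (rmeas mu (S `\` A) *: c + sint mu (S `\` A) l).
  by apply: IH => // t [St At]; have := Pc t St; rewrite sval_consF.
by have := PD _ _ h1 h2; rewrite scalerDr addrACA !addrA (addrAC (_ *: c)).
Qed.

Lemma bochner_int_closed_cone (P : set Y) S f y : positive_cone P -> measurable S ->
  (forall t, S t -> P (f t)) -> bochner_int mu S f y -> P y.
Proof.
move=> hP mS fP Hf; have [l bl _] := (iffLR (bochner_intP _ _ _ _)) Hf.
have [k bk kP] := bapprox_in_range mS bl; have [mk _ _] := bk.
have kcvg := sint_bapprox_cvg mufin cmu mS bk.
have kint : bochner_int mu S f (lim (sint mu S (k n) @[n --> \oo])).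
  by apply/bochner_intP; exists k.
rewrite (bochner_int_uniq mufin cmu mS Hf kint).
have [_ _ _ _ clP] := hP.
apply: (closed_cvg P clP _ _ kcvg); apply: nearW => n.
apply: sint_closed_cone => // t St.
by have [u Su ->] := kP n t St; exact: fP.
Qed.

End BochnerCone.

(** * Intermediate values of an atomless measure *)

Section Atomless.
Context {R : realType} {d : measure_display} {T : measurableType d}.
Variable mu : {measure set T -> \bar R}.
Hypothesis mufin : (mu setT < +oo)%E.
Variable T0 : set T.
Hypothesis mT0 : measurable T0.
Hypothesis atomless : forall A, measurable A -> A `<=` T0 -> (0 < mu A)%E ->
  exists B, [/\ measurable B, B `<=` A, (0 < mu B)%E & (mu B < mu A)%E].
Implicit Types (A B S : set T).
Local Notation m := (rmeas mu).

Lemma rmeasD A B : measurable A -> measurable B -> B `<=` A -> m (A `\` B) = m A - m B.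
Proof.
move=> mA mB BA; rewrite (rmeas_split mufin mA mB) (setIidr BA).
by rewrite addrAC subrr add0r.
Qed.

Lemma rmeas_gt0 A : measurable A -> (0 < m A) = (0 < mu A)%E.
Proof. by move=> mA; rewrite (rmeasE mufin mA) lte_fin. Qed.

Lemma atomless_small A n : measurable A -> A `<=` T0 -> 0 < m A ->
  exists B, [/\ measurable B, B `<=` A, 0 < m B & m B <= m A / 2 ^+ n].
Proof.
move=> mA AT0 A0; elim: n => [|n [B [mB BA B0 Bn]]].
  by exists A; split => //; rewrite expr0 divr1.
have := B0; rewrite rmeas_gt0// => /(atomless mB (subset_trans BA AT0))[C [mC CB C0 CltB]].
have {}C0 : 0 < m C by rewrite rmeas_gt0.
have {}CltB : m C < m B by rewrite -lte_fin -!(rmeasE mufin).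
have [CB2|CB2] := leP (m C) (m B / 2).
  exists C; split => //; first exact: subset_trans BA.
  rewrite exprSr invfM mulrA (le_trans CB2)// ler_pM2r// invr_gt0; lra.
exists (B `\` C); rewrite rmeasD//; split.
- exact: measurableD.
- by move=> t [/BA].
- by rewrite subr_gt0.
- rewrite exprSr invfM mulrA; lra.
Qed.

(** Greedy exhaustion of [A] below the level [c]: every step adds a set at least half as large as
    any that still fits, so a gap left in the limit contradicts the convergence of the measures. *)
Lemma sierpinski A c : measurable A -> A `<=` T0 -> 0 <= c <= m A ->
  exists B, [/\ measurable B, B `<=` A & m B = c].
Proof.
move=> mA AT0 /andP[c0 cA].
pose ok B := [/\ measurable B, B `<=` A & m B <= c].
have /choice[step stepP] : forall B, exists B', ok B -> [/\ ok B', B `<=` B' &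
    forall D, measurable D -> D `<=` A `\` B -> m B + m D <= c ->
      m D <= 2 * (m B' - m B)].
  move=> B; have [[mB BA Bc]|?] := pselect (ok B); last by exists B.
  pose Q := [set m D | D in [set D | [/\ measurable D, D `<=` A `\` B & m B + m D <= c]]].
  have Qsup : has_sup Q.
    split; last by exists c => _ [D [_ _ h] <-]; have := rmeas_ge0 mu B; lra.
    exists 0; exists set0; last by rewrite /rmeas measure0.
    by split => //; rewrite /rmeas measure0 addr0.
  have [D [mD DAB BDc] DQ] : exists2 D, [/\ measurable D, D `<=` A `\` B &
      m B + m D <= c] & forall D', measurable D' -> D' `<=` A `\` B ->
      m B + m D' <= c -> m D' <= 2 * m D.
    (* If the supremum is 0, only null sets fit and the empty set will do; otherwise some admissible
       set exceeds half of the supremum. *)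
    have [s0|s0] := leP (sup Q) 0.
      exists set0; first by split => //; rewrite /rmeas measure0 addr0.
      move=> D' *; rewrite [in leRHS]/rmeas measure0 mulr0 (le_trans _ s0)//.
      by apply: ub_le_sup; [case: Qsup|exists D'].
    have s20 : 0 < sup Q / 2 by rewrite divr_gt0.
    have [_ [D DP <-] Dlt] := sup_adherent s20 Qsup.
    exists D => // D' *; have : m D' <= sup Q by apply: ub_le_sup; [case: Qsup|exists D'].
    lra.
  have BD : B `&` D = set0 by apply/seteqP; split => // t [Bt /DAB[]].
  exists (B `|` D) => _; split.
  - split; [exact: measurableU|by move=> t [/BA//|/DAB[]]|by rewrite rmeasU].
  - exact: subsetUl.
  - by move=> D' *; rewrite rmeasU// addrAC subrr add0r; exact: DQ.
pose F n := iter n step set0.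
have okF n : ok (F n).
  elim: n => [|n IH]; last by case: (stepP _ IH).
  by split; rewrite ?/F//= /rmeas measure0.
have mF n : measurable (F n) by case: (okF n).
have ndF : nondecreasing_seq F.
  by apply/nondecreasing_seqP => n; rewrite subsetEset; case: (stepP _ (okF n)).
have mU : measurable (\bigcup_n F n) by exact: bigcupT_measurable.
have UA : \bigcup_n F n `<=` A by move=> t [n _]; case: (okF n) => _ + _; exact.
have Fcvg : m (F n) @[n --> \oo] --> m (\bigcup_n F n).
  apply: (fine_cvg (f := mu \o F)); rewrite -(rmeasE mufin mU).
  exact: nondecreasing_cvg_mu.
have Uc : m (\bigcup_n F n) <= c.
  by apply: (closed_cvg _ (@closed_le _ c) _ _ Fcvg); apply: nearW => n; case: (okF n).
exists (\bigcup_n F n); split => //; apply/eqP; rewrite eq_le Uc leNgt; apply/negP => Ult.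
have mAU := measurableD mA mU.
have AU0 : 0 < m (A `\` \bigcup_n F n) by rewrite rmeasD//; lra.
have [D [mD DAU D0 Dc]] : exists D, [/\ measurable D, D `<=` A `\` \bigcup_n F n,
    0 < m D & m D <= c - m (\bigcup_n F n)].
  (* After [n.+1] halvings the set fits into the gap, since [2 ^+ n.+1] exceeds [n.+1], which
     exceeds the quotient. *)
  pose n := Num.truncn (m (A `\` \bigcup_n F n) / (c - m (\bigcup_n F n))).
  have [|D [mD DAU D0 Dn]] := @atomless_small _ n.+1 mAU _ AU0.
    by move=> t [/AT0].
  exists D; split => //; apply: (le_trans Dn).
  rewrite ler_pdivrMr ?exprn_gt0// mulrC -ler_pdivrMr ?subr_gt0//.
  rewrite (le_trans (ltW (truncnS_gt _)))// -natrX ler_nat.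
  by apply: ltnW; apply: ltn_expl.
(* [D] avoids every [F n] and fits at every stage, so no increment is below half of [m D]. *)
have Dstep n : m D <= 2 * (m (F n.+1) - m (F n)).
  case: (stepP _ (okF n)) => _ _; apply => //.
    by move=> t /DAU[At nU]; split => // Ft; apply: nU; exists n.
  have : m (F n) <= m (\bigcup_n F n) by apply: le_rmeas => // t Ft; exists n.
  lra.
suff : m D <= 2 * (m (\bigcup_n F n) - m (\bigcup_n F n)) by rewrite subrr mulr0; lra.
have lim0 : 2 * (m (F n.+1) - m (F n)) @[n --> \oo] -->
    2 * (m (\bigcup_n F n) - m (\bigcup_n F n)).
  apply: cvgM; first exact: cvg_cst.
  by apply: cvgB => //; rewrite (cvg_shiftS (fun n => m (F n))).
by apply: (closed_cvg _ (@closed_ge _ (m D)) _ _ lim0); apply: nearW => n; exact: Dstep.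
Qed.

(** Halve [T0] repeatedly and keep the half that contains [t]. Points are not assumed measurable
    here, hence negligibility as the conclusion. *)
Lemma atomless_set1_negligible t : T0 t -> mu.-negligible [set t].
Proof.
move=> T0t.
have /choice[B BP] : forall n, exists B,
    [/\ measurable B, B `<=` T0, B t & m B <= m T0 / 2 ^+ n].
  elim=> [|n [B [mB BT0 Bt Bn]]]; first by exists T0; split; rewrite ?expr0 ?divr1.
  have B0 := rmeas_ge0 mu B.
  have [|C [mC CB CE]] := sierpinski (c := m B / 2) mB BT0; first by apply/andP; split; lra.
  have Bn2 : m B / 2 <= m T0 / 2 ^+ n.+1 by rewrite exprSr invfM mulrA; lra.
  have [Ct|nCt] := pselect (C t).
    by exists C; split; rewrite ?CE//; exact: subset_trans BT0.
  exists (B `\` C); split => //; first exact: measurableD.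
    by move=> s [/BT0].
  by rewrite rmeasD// CE; lra.
have mN : measurable (\bigcap_n B n).
  by apply: bigcapT_measurable => n; case: (BP n).
exists (\bigcap_n B n); split => //; last by move=> _ -> n _; case: (BP n).
rewrite (rmeasE mufin mN); congr EFin; apply/eqP; rewrite eq_le rmeas_ge0 andbT.
rewrite leNgt; apply/negP => N0.
have le n : m (\bigcap_n B n) <= m T0 / 2 ^+ n.
  have [mB _ _ ] := BP n; apply: le_trans; apply: le_rmeas => //; exact: bigcap_inf.
pose n := Num.truncn (m T0 / m (\bigcap_n B n)).
have := le n.+1; apply/negP; rewrite -ltNge.
rewrite ltr_pdivrMr ?exprn_gt0// mulrC -ltr_pdivrMr//.
rewrite (lt_le_trans (truncnS_gt _))// -natrX ler_nat.
by apply: ltnW; apply: ltn_expl.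
Qed.

(** Cutting [S] along the first set and recursing in both pieces makes the proportion exact for all
    sets of the list at once: Lyapunov convexity for simple functions. *)
Lemma atomless_fraction (As : seq (set T)) S (k : R) : 0 <= k <= 1 ->
  measurable S -> S `<=` T0 -> (forall A, A \in As -> measurable A) ->
  exists B, [/\ measurable B, B `<=` S, m B = k * m S &
    forall A, A \in As -> m (A `&` B) = k * m (A `&` S)].
Proof.
move=> /andP[k0 k1]; elim: As S => [|A As IH] S mS ST0 mAs.
  have S0 := rmeas_ge0 mu S.
  have [|B [mB BS BE]] := sierpinski (c := k * m S) mS ST0.
    by rewrite mulr_ge0//= ler_piMl.
  by exists B; split.
have mA : measurable A by apply: mAs; rewrite mem_head.
have mAs' A' : A' \in As -> measurable A' by move=> h; apply: mAs; rewrite in_cons h orbT.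
have mSA := measurableI _ _ mS mA; have mSDA := measurableD mS mA.
have [|B1 [mB1 B1S B1E B1P]] := IH _ mSA _ mAs'; first by move=> t [/ST0].
have [|B2 [mB2 B2S B2E B2P]] := IH _ mSDA _ mAs'; first by move=> t [/ST0].
have B12 : B1 `&` B2 = set0 by apply/seteqP; split => // t [/B1S[_ At] /B2S[]].
exists (B1 `|` B2); split.
- exact: measurableU.
- by move=> t [/B1S[]|/B2S[]].
- by rewrite rmeasU// B1E B2E -mulrDr -rmeas_split.
- move=> A'; rewrite in_cons => /orP[/eqP ->|A'As].
    rewrite setIUr (setIidr (subset_trans B1S (@subIsetr _ _ _))).
    have -> : A `&` B2 = set0 by apply/seteqP; split => // t [At /B2S[_]].
    by rewrite setU0 setIC.
  have mA' := mAs' _ A'As.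
  rewrite setIUr rmeasU//.
  + rewrite B1P// B2P// -mulrDr (rmeas_split mufin (measurableI _ _ mA' mS) mA).
    by rewrite setIA setIDA.
  + exact: measurableI.
  + exact: measurableI.
  + by apply/seteqP; split => // t [[_ /B1S[_ At]] [_ /B2S[]]].
Qed.

End Atomless.

(** * Approximate Lyapunov convexity *)

Section BochnerFraction.
Context {R : realType} {d : measure_display} {T : measurableType d}
  {Y : completeNormedModType R}.
Variable mu : {measure set T -> \bar R}.
Hypothesis mufin : (mu setT < +oo)%E.
Hypothesis cmu : measure_is_complete mu.
Variable T0 : set T.

Hypothesis atomless : forall A, measurable A -> A `<=` T0 -> (0 < mu A)%E ->
  exists B, [/\ measurable B, B `<=` A, (0 < mu B)%E & (mu B < mu A)%E].
Implicit Types (S A B : set T) (f g h : T -> Y) (y z : Y).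

Lemma smeas_mem (l : seq (set T * Y)) A : smeas l -> A \in map fst l -> measurable A.
Proof.
elim: l => //= -[B x] l IH [mB ml]; rewrite in_cons => /orP[/eqP -> //|]; exact: IH.
Qed.

Lemma bochner_simple_lt S f y (eps : R) : measurable S -> bochner_int mu S f y -> 0 < eps ->
  exists2 l, smeas l & (\int[mu]_(t in S) `|f t - simple_val l t|%:E < eps%:E)%E.
Proof.
move=> mS /bochner_intP[l [ml _ HL] _] eps0.
by have [N _ HN] := cvg0_near_lt HL eps0; exists (l N) => //; apply: (HN N) => /=.
Qed.

Lemma sint_fraction S B (k : R) (l : seq (set T * Y)) :
  (forall A, A \in map fst l -> rmeas mu (A `&` B) = k * rmeas mu (A `&` S)) ->
  sint mu B l = k *: sint mu S l.
Proof.
move=> H; rewrite /sint scaler_sumr; apply: eq_big_seq => p pl.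
by rewrite H ?scalerA//; exact: map_f.
Qed.

(* An approximate Lyapunov convexity theorem: exact on simple functions,
   then transported to Bochner integrals by L1-approximation. *)
Lemma bochner_fraction S f g y z (k eps : R) : measurable S -> S `<=` T0 ->
  bochner_int mu S f y -> bochner_int mu S g z -> 0 <= k <= 1 -> 0 < eps ->
  exists B y' z', [/\ measurable B, B `<=` S,
    bochner_int mu B f y' /\ bochner_int mu B g z',
    `|y' - k *: y| <= eps & `|z' - k *: z| <= eps].
Proof.
move=> mS ST0 Hf Hg k01 eps0; have e2 : 0 < eps / 2 by rewrite divr_gt0.
have [l1 ml1 L1] := bochner_simple_lt mS Hf e2.
have [l2 ml2 L2] := bochner_simple_lt mS Hg e2.
have [|B [mB BS _ BP]] :=
    atomless_fraction mufin atomless (As := map fst l1 ++ map fst l2) k01 mS ST0.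
  by move=> A; rewrite mem_cat => /orP[]; exact: smeas_mem.
have near h w l : smeas l -> bochner_int mu S h w ->
    (\int[mu]_(t in S) `|h t - simple_val l t|%:E < (eps / 2)%:E)%E ->
    (forall A, A \in map fst l -> rmeas mu (A `&` B) = k * rmeas mu (A `&` S)) ->
    exists2 w', bochner_int mu B h w' & `|w' - k *: w| <= eps.
  move=> ml Hh L lP; have [w' Hw'] : bochner_integrable mu B h.
    by apply: bochner_integrable_sub mS mB BS _ => //; exists w.
  exists w' => //.
  have h1 : `|w' - sint mu B l| <= eps / 2.
    rewrite -lee_fin (le_trans (bochner_int_sub_sint mufin cmu mB Hw' ml))//.
    rewrite (le_trans _ (ltW L))//; apply: ge0_subset_integral => //.
    apply/measurable_EFinP; have [l' bl' _] := (iffLR (bochner_intP _ _ _ _)) Hh.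
    exact: measurable_bapprox bl' _.
  have h2 : `|w - sint mu S l| <= eps / 2.
    by rewrite -lee_fin (le_trans (bochner_int_sub_sint mufin cmu mS Hh ml))// ltW.
  rewrite -(subrKA (sint mu B l)) (le_trans (ler_normD _ _))// [leRHS]splitr lerD//.
  rewrite (sint_fraction lP) -scalerBr normrZ distrC.
  have /andP[k0 k1] := k01; rewrite ger0_norm// (le_trans _ h2)// ler_piMl//.
have [|y' Hy' y'le] := near f y l1 ml1 Hf L1.
  by move=> A hA; apply: BP; rewrite mem_cat hA.
have [|z' Hz' z'le] := near g z l2 ml2 Hg L2.
  by move=> A hA; apply: BP; rewrite mem_cat hA orbT.
by exists B, y', z'.
Qed.

End BochnerFraction.

(** * Interior points of the positive cone *)

Section ConeInterior.
Context {R : realType} {Y : completeNormedModType R}.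
Variable P : set Y.
Hypothesis coneP : positive_cone P.
Implicit Types x y z : Y.

Lemma cone_interiorP x : P° x <-> exists2 e : R, 0 < e & forall u, `|u| < e -> P (x + u).
Proof.
split.
  move=> /nbhs_ballP[e e0 eP]; exists e => // u ue; apply: eP.
  by rewrite -ball_normE /ball_/= opprD addrA subrr add0r normrN.
move=> [e e0 eP]; apply/nbhs_ballP; exists e => // u.
rewrite -ball_normE /ball_/= => xu; rewrite -(subrK x u) addrC; apply: eP.
by rewrite distrC.
Qed.

Lemma cone_interiorZ k x : 0 < k -> P° x -> P° (k *: x).
Proof.
move=> k0 /cone_interiorP[e e0 eP]; apply/cone_interiorP; exists (k * e).
  by rewrite mulr_gt0.
move=> u ue; have -> : k *: x + u = k *: (x + k^-1 *: u).
  by rewrite scalerDr scalerA divff ?scale1r// gt_eqF.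
have [_ _ PZ _ _] := coneP; apply: PZ; first exact: ltW.
by apply: eP; rewrite normrZ gtr0_norm ?invr_gt0// mulrC ltr_pdivrMr// mulrC.
Qed.

Lemma cone_interiorD x y : P° x -> P y -> P° (x + y).
Proof.
move=> /cone_interiorP[e e0 eP] Py; apply/cone_interiorP; exists e => // u ue.
by rewrite addrAC; have [_ PD _ _ _] := coneP; apply: PD => //; exact: eP.
Qed.

Lemma cone_interiorW x : P° x -> P x.
Proof. exact: interior_subset. Qed.

End ConeInterior.

(** * Distance to a set *)

Section InfDist.
Context {R : realType} {Y : completeNormedModType R}.
Variable C : set Y.
Hypothesis C0 : C !=set0.

Definition infdist (x : Y) : R := inf [set `|x - p| | p in C].

Lemma infdist_has_inf x : has_inf [set `|x - p| | p in C].
Proof.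
by have [p Cp] := C0; split; [exists `|x - p|; exists p|exists 0 => _ [q _ <-]].
Qed.

Lemma infdist_lip x y : infdist x <= infdist y + `|x - y|.
Proof.
rewrite -lerBlDr; apply: lb_le_inf; first by case: (infdist_has_inf y).
move=> _ [p Cp <-]; rewrite lerBlDr; apply: le_trans (_ : `|x - p| <= _).
  by apply: ge_inf; [case: (infdist_has_inf x)|exists p].
by rewrite [leRHS]addrC ler_distD.
Qed.

Lemma infdist_continuous : continuous infdist.
Proof.
move=> x; apply/cvgrPdist_lt => e e0.
near=> y; have := infdist_lip x y; have := infdist_lip y x; rewrite distrC => h1 h2.
have : `|x - y| < e by near: y; exact: cvgr_dist_lt.
by move=> xy; rewrite ltr_norml; apply/andP; split; lra.
Unshelve. all: by end_near. Qed.

Lemma infdist_eq0 x : closed C -> infdist x = 0 <-> C x.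
Proof.
move=> clC; split=> [x0|Cx].
  apply: clC => A /nbhs_ballP[e e0 eA].
  have [_ [p Cp <-] /=] := inf_adherent e0 (infdist_has_inf x).
  rewrite -/(infdist x) x0 add0r => px; exists p; split => //; apply: eA.
  by rewrite -ball_normE.
apply/eqP; rewrite eq_le; apply/andP; split.
  by rewrite -(@normr0 _ Y) -(subrr x); apply: ge_inf; [case: (infdist_has_inf x)|exists x].
by apply: lb_le_inf; [case: (infdist_has_inf x)|move=> _ [p _ <-]].
Qed.

End InfDist.

(** * Measurable composition and interior-valued integrals *)

Section Caratheodory.
Context {R : realType} {d : measure_display} {T : measurableType d}
  {Y : completeNormedModType R}.
Variable mu : {measure set T -> \bar R}.
Hypothesis mufin : (mu setT < +oo)%E.
Hypothesis cmu : measure_is_complete mu.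
Implicit Types (S A B : set T) (f g h : T -> Y) (y z : Y).

Lemma within_continuous_seq (P : set Y) (F : Y -> R) (x : nat -> Y) (y : Y) :
  {within P, continuous F} -> P y -> (forall n, P (x n)) ->
  x n @[n --> \oo] --> y -> F (x n) @[n --> \oo] --> F y.
Proof.
move=> /subspace_continuousP cF Py Px xy.
apply: cvg_comp (cF y Py) => A; rewrite /within/= => nA.
have : \forall n \near \oo, P (x n) -> A (x n) by exact: (xy _ nA).
by apply: filterS => n; exact.
Qed.

(** Approximants that take values of [g] never leave [P], so continuity of [V t] within [P] exhibits
    the composition as an almost everywhere limit of measurable functions. *)
Lemma measurable_caratheodory (P : set Y) (V : T -> Y -> R) S g y : measurable S ->
  (forall x, P x -> measurable_fun setT (V ^~ x)) ->
  (forall t, {within P, continuous (V t)}) ->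
  (forall t, S t -> P (g t)) -> bochner_int mu S g y ->
  measurable_fun S (fun t => V t (g t)).
Proof.
move=> mS mV cV Pg /bochner_intP[l bl _].
have [k [mk kae _] kP] := bapprox_in_range mufin cmu mS bl.
(* Off [P] nothing is known about [V]; the value 0 makes [W] measurable at every vector and is never
   consulted at points of [S]. *)
pose W t x : R := if `[< P x >] then V t x else 0.
apply: (measurable_fun_ae_cvg cmu (h := fun n t => W t (0 + simple_val (k n) t))) => //.
  move=> n; apply: measurable_sval => // x; rewrite /W.
  by case: asboolP => Px; [exact: mV|exact: measurable_cst].
apply: filterS kae => t Ht St.
have Pk n : P (simple_val (k n) t) by have [u Su ->] := kP n t St; exact: Pg.
have -> : (fun n => W t (0 + simple_val (k n) t)) = (fun n => V t (simple_val (k n) t)).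
  by apply: funext => n; rewrite add0r /W asboolT.
by apply: within_continuous_seq (cV t) (Pg t St) Pk (Ht St).
Qed.

(** Membership in [C] becomes the vanishing of a continuous real function, so that no sigma-algebra
    on [Y] has to be introduced. *)
Lemma measurable_bochner_closed (C : set Y) S h y : closed C -> C !=set0 ->
  measurable S -> bochner_int mu S h y -> measurable (S `&` h @^-1` C).
Proof.
move=> clC C0 mS Hh.
have mh : measurable_fun S (fun t => infdist C (h t)).
  apply: (@measurable_caratheodory setT (fun _ => infdist C) S h y) => //.
  by move=> t; apply: continuous_subspaceT; exact: infdist_continuous.
have := mh mS [set 0] (measurable_set1 0).
congr measurable; apply/seteqP; split => t /= [St].
  by move/(infdist_eq0 C0 _ clC).
by move=> Ct; split => //; apply/(infdist_eq0 C0 _ clC).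
Qed.

(** Closedness alone gives only [P y]. The sets [Sn n], where [h] dominates [r n *: e] for a fixed
    interior [e], cover [S]; one of them has positive measure and contributes a positive multiple of
    [e]. *)
Lemma bochner_int_interior (P : set Y) S h y : positive_cone P -> measurable S ->
  (0 < mu S)%E -> (forall t, S t -> P° (h t)) -> bochner_int mu S h y -> P° y.
Proof.
move=> hP mS S0 Ph Hh; have [P0 PD PZ _ clP] := hP.
have [t0 St0] : S !=set0.
  by apply/set0P/eqP => S0'; move: S0; rewrite S0' measure0 ltxx.
pose e := h t0; have Pe : P° e by exact: Ph.
pose r n : R := n.+1%:R^-1.
pose Sn n := S `&` (fun t => h t - r n *: e) @^-1` P.
have Hhn n : bochner_int mu S (fun t => h t - r n *: e) (y - rmeas mu S *: (r n *: e)).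
  by apply: bochner_intB => //; exact: bochner_int_cst.
have mSn n : measurable (Sn n) by apply: measurable_bochner_closed (Hhn n) => //; exists 0.
have [n Sn0] : exists n, (0 < mu (Sn n))%E.
  apply: contrapT => /forallNP H; move: S0; apply/negP; rewrite -leNgt measure_le0.
  apply/eqP/measure_negligible => //.
  apply: (@negligibleS _ _ _ _ (\bigcup_n Sn n)); last first.
    apply: negligible_bigcup => n; apply/negligibleP => //; apply/eqP.
    by rewrite -measure_le0 leNgt; apply/negP; exact: H.
  move=> t St; have /cone_interiorP[eps eps0 Peps] := Ph t St.
  have /cvgr0Pnorm_lt/(_ _ eps0)[N _ HN] : r n *: e @[n --> \oo] --> 0.
    rewrite -[0](scale0r e); apply: cvgZ; last exact: cvg_cst.
    exact: cvg_harmonic.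
  by exists N => //; split => //; apply: Peps; rewrite normrN; exact: (HN N (leqnn N)).
have mD := measurableD mS (mSn n).
have [y1 [y2 [H1 H2 yE]]] :=
  bochner_int_split mufin cmu mS (mSn n) (@subIsetl _ _ _) Hh.
have Py2 : P y2.
  apply: (bochner_int_closed_cone mufin cmu hP mD _ H2) => t [St _].
  by apply: cone_interiorW; exact: Ph.
have Py1 : P (y1 - rmeas mu (Sn n) *: (r n *: e)).
  apply: (bochner_int_closed_cone mufin cmu hP (mSn n) (f := fun t => h t - r n *: e)).
    by move=> t [].
  by apply: bochner_intB => //; exact: bochner_int_cst.
rewrite yE; apply: cone_interiorD => //.
rewrite -(subrK (rmeas mu (Sn n) *: (r n *: e)) y1) addrC.
apply: cone_interiorD => //; apply: cone_interiorZ => //; first by rewrite rmeas_gt0.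
by apply: cone_interiorZ => //; rewrite invr_gt0.
Qed.

End Caratheodory.

(** * Freeing resources while keeping strict preference *)

Section Slack.
Context {R : realType} {d : measure_display} {T : measurableType d}
  {Y : completeNormedModType R}.
Variable mu : {measure set T -> \bar R}.
Hypothesis mufin : (mu setT < +oo)%E.
Hypothesis cmu : measure_is_complete mu.
Variables (P : set Y) (V : T -> Y -> R).
Hypothesis coneP : positive_cone P.
Hypothesis mV : forall x, P x -> measurable_fun setT (V ^~ x).
Hypothesis cV : forall t, {within P, continuous (V t)}.
Implicit Types (S A B : set T) (f g h : T -> Y) (y z : Y).

Lemma integral_norm_vanishing S f y (A : nat -> set T) : measurable S ->
  bochner_int mu S f y -> (forall n, measurable (A n)) -> (forall n, A n `<=` S) ->
  {ae mu, forall t, S t -> \forall n \near \oo, ~ A n t} ->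
  (\int[mu]_(t in A n) `|f t|%:E)%E @[n --> \oo] --> 0%E.
Proof.
move=> mS Hf mA AS Aae.
have /measurable_EFinP mf := measurable_norm_bochner cmu mS Hf.
pose F n := (fun t => `|f t|%:E) \_ (A n).
have FE n t : F n t = if t \in A n then `|f t|%:E else 0%E by [].
have -> : (fun n => \int[mu]_(t in A n) `|f t|%:E)%E =
    (fun n => \int[mu]_(t in S) F n t)%E.
  by apply: funext => n; rewrite -integral_mkcondr (setIidr (AS n)).
have [|||||_ _] := @dominated_convergence _ _ _ mu S mS F (cst 0%E) (fun t => `|f t|%:E).
- move=> n; apply/measurable_restrict => //.
  by apply: measurable_funS mf => //; exact: subIsetl.
- exact: measurable_cst.
- apply: filterS Aae => t /[swap] St /(_ St) [N _ HN].
  apply: cvg_near_cst; exists N => // n Nn.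
  by rewrite FE memNset//; exact: HN.
- apply/integrableP; split => //.
  under eq_integral do rewrite /= normr_id.
  exact: (bochner_integral_norm_lty mufin cmu mS Hf).
- by apply: aeW => t n St; rewrite FE; case: ifP => _ /=; rewrite ?normr_id ?normr0 lee_fin.
- by rewrite integral0.
Qed.

(* Strict preference for [g] over [f] survives shrinking [g] by a factor
   [1 - r n] on all but a small set, which frees a strictly positive amount. *)
Lemma strict_preference_slack S f g yf yg : measurable S ->
  (forall t, S t -> P (f t)) -> (forall t, S t -> P (g t)) ->
  bochner_int mu S f yf -> bochner_int mu S g yg -> P° yg ->
  {ae mu, forall t, S t -> V t (f t) < V t (g t)} ->
  exists g' z, [/\ forall t, S t -> P (g' t), bochner_int mu S g' (yg - z), P° z &
    {ae mu, forall t, S t -> V t (f t) < V t (g' t)}].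
Proof.
move=> mS Pf Pg Hf Hg Pyg fg; have [P0 PD PZ _ clP] := coneP.
pose r n : R := n.+2%:R^-1.
have r01 n : 0 < r n < 1 by rewrite invr_gt0 ltr0n invf_lt1// ltr1n.
have r0 : r n @[n --> \oo] --> (0 : R).
  by have := @cvg_harmonic R; rewrite -(cvg_shiftS (@harmonic R)).
pose gn n t := (1 - r n) *: g t.
have Pgn n t : S t -> P (gn n t).
  by move=> St; apply: PZ; [have := r01 n; lra|exact: Pg].
have Hgn n : bochner_int mu S (gn n) ((1 - r n) *: yg) by exact: bochner_intZ.
pose Sn n := S `&` [set t | V t (f t) < V t (gn n t)].
have mSn n : measurable (Sn n).
  have := measurable_fun_ltr (measurable_caratheodory mufin cmu mS mV (@cV) Pf Hf)
    (measurable_caratheodory mufin cmu mS mV (@cV) (Pgn n) (Hgn n)).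
  by move=> /(_ mS [set true] I).
have vanish : (\int[mu]_(t in S `\` Sn n) `|g t|%:E)%E @[n --> \oo] --> 0%E.
  apply: (integral_norm_vanishing mS Hg) => //; first by move=> n; exact: measurableD.
  apply: filterS fg => t /[swap] St /(_ St) fgt.
  have gncvg : gn n t @[n --> \oo] --> g t.
    rewrite -[X in _ --> X]scale1r -[X in _ --> X *: _]subr0.
    by apply: cvgZ; [apply: cvgB => //; exact: cvg_cst|exact: cvg_cst].
  have Vcvg := within_continuous_seq (@cV t) (Pg t St) (fun n => Pgn n t St) gncvg.
  have : \forall n \near \oo, V t (f t) < V t (gn n t).
    have e0 : 0 < V t (g t) - V t (f t) by rewrite subr_gt0.
    move/cvgrPdist_lt/(_ _ e0) : Vcvg; apply: filterS => n.
    by rewrite ltr_norml => /andP[_]; rewrite ltrD2l ltrN2.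
  by apply: filterS => n h [_]; apply.
(* [n] is so large that the integral [w] of [g] over the bad set is shorter than [e]. Then
   [v = yg - w] is still interior, and shrinking on [Sn n] frees [r n *: v]. *)
have /cone_interiorP[e e0 eP] := Pyg.
have [n /= wn] := filter_ex (cvg0_near_lt vanish e0).
have [v [w [Hv Hw ygE]]] := bochner_int_split mufin cmu mS (mSn n) (@subIsetl _ _ _) Hg.
have we : `|w| < e.
  rewrite -lte_fin; apply: le_lt_trans wn.
  by apply: (bochner_int_norm mufin cmu _ Hw); exact: measurableD.
have Pv : P° v.
  apply/cone_interiorP; exists (e - `|w|); first by rewrite subr_gt0.
  move=> u ue; rewrite (_ : v + u = yg + (u - w)); last first.
    by rewrite ygE [u - w]addrC addrA addrK.
  by apply: eP; rewrite (le_lt_trans (ler_normB _ _))// -ltrBrDr.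
pose g' t := if `[< Sn n t >] then gn n t else g t.
have g'1 t : Sn n t -> g' t = gn n t by move=> h; rewrite /g' asboolT.
have g'2 t : ~ Sn n t -> g' t = g t by move=> h; rewrite /g' asboolF.
exists g', (r n *: v); split.
- by move=> t St; rewrite /g'; case: asboolP => _; [exact: Pgn|exact: Pg].
- have -> : yg - r n *: v = (1 - r n) *: v + w.
    by rewrite ygE scalerBl scale1r addrAC.
  have SE : Sn n `|` (S `\` Sn n) = S by apply: setDUK; exact: subIsetl.
  rewrite -[X in bochner_int _ X]SE.
  apply: (bochner_int_setU cmu (mSn n) (measurableD mS (mSn n)) (setDIK _ _)).
    apply: (bochner_int_eq (f := gn n)); first by move=> t /g'1.
    exact: bochner_intZ.
  by apply: (bochner_int_eq (f := g)) Hw => t [_ /g'2].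
- by apply: cone_interiorZ => //; have /andP[] := r01 n.
- apply: filterS fg => t /[swap] St /(_ St) fgt; have [h|h] := pselect (Sn n t).
    by rewrite g'1//; case: h.
  by rewrite g'2.
Qed.

End Slack.

(** * Atoms of sigma-algebras on the finite state space *)

Section Information.
Context {Om : finType}.
Implicit Types (H : set (set Om)) (PS : set (set (set Om))) (Q : set (set Om)).

Lemma sigma_setC H X : sigma_algebra setT H -> H X -> H (~` X).
Proof. by move=> [_ HC _] /HC; rewrite setTD. Qed.

Lemma sigma_setT H : sigma_algebra setT H -> H setT.
Proof. by move=> sH; rewrite -setC0; apply: sigma_setC => //; case: sH. Qed.

Lemma sigma_bigcup H (X : set Om) (F : Om -> set Om) : sigma_algebra setT H ->
  (forall w, X w -> H (F w)) -> H (\bigcup_(w in X) F w).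
Proof.
move=> [H0 _ HU] XF.
pose A n := if @unpickle Om n is Some w then (if `[< X w >] then F w else set0) else set0.
have -> : \bigcup_(w in X) F w = \bigcup_n A n.
  apply/seteqP; split => w' [].
    by move=> w Xw Fw; exists (pickle w) => //; rewrite /A pickleK asboolT.
  move=> n _; rewrite /A; case: unpickle => // w; case: asboolP => // Xw Fw.
  by exists w.
by apply: HU => n; rewrite /A; case: unpickle => // w; case: asboolP => // /XF.
Qed.

Lemma sigma_atom_mem H w : sigma_algebra setT H -> H (sigma_atom H w).
Proof.
move=> sH.
have /choice[D DP] : forall w', exists D, ~ sigma_atom H w w' -> [/\ H D, D w & ~ D w'].
  move=> w'; have [h|/existsNP[D /not_implyP[HD /not_implyP[Dw Dw']]]] :=
    pselect (sigma_atom H w w'); first by exists set0.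
  by exists D.
have -> : sigma_atom H w = ~` \bigcup_(w' in ~` sigma_atom H w) ~` D w'.
  apply/seteqP; split => w'.
    by move=> h [v /DP[HD Dw _]]; apply; exact: h.
  by move=> h; apply: contrapT => h'; apply: h; exists w' => //; case: (DP _ h').
apply: sigma_setC => //; apply: sigma_bigcup => // w' /DP[HD _ _].
exact: sigma_setC.
Qed.

Lemma sigma_atom_refl H w : sigma_atom H w w.
Proof. by move=> A _. Qed.

Lemma sigma_atom_trans H w1 w2 w3 :
  sigma_atom H w1 w2 -> sigma_atom H w2 w3 -> sigma_atom H w1 w3.
Proof. by move=> h12 h23 A HA /(h12 A HA)/(h23 A HA). Qed.

Lemma Gmeas_atom (V : Type) H (h : Om -> V) w w' :
  Gmeas H h -> sigma_atom H w w' -> h w' = h w.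
Proof. by move=> Hh /(_ _ (Hh (h w)) erefl). Qed.

Lemma Gmeas_cst (V : Type) H (v : V) : sigma_algebra setT H -> Gmeas H (fun=> v).
Proof.
move=> sH u; have [<-|vu] := pselect (v = u).
  by rewrite (_ : _ @^-1` _ = setT); [exact: sigma_setT|by apply/seteqP; split].
by rewrite (_ : _ @^-1` _ = set0); [case: sH|by apply/seteqP; split].
Qed.

(** Reduces an interim comparison on an atom to one of single values; the positive prior keeps the
    denominator positive. *)
Lemma cond_exp_atom (R : realType) (q : Om -> R) H (X : Om -> R) w c :
  (forall w', 0 < q w') -> (forall w', sigma_atom H w w' -> X w' = c) ->
  cond_exp q H X w = c.
Proof.
move=> q0 Xc; rewrite /cond_exp.
have -> : \sum_w' (\1_(sigma_atom H w) w' : R) * X w' * q w' =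
    c * \sum_w' (\1_(sigma_atom H w) w' : R) * q w'.
  rewrite mulr_sumr; apply: eq_bigr => w' _; rewrite indicE.
  have [/set_mem/Xc ->|_] := boolP (w' \in _); first by rewrite !mul1r.
  by rewrite !mul0r mulr0.
rewrite mulfK// gt_eqF// (bigD1 w)//= ltr_wpDr//.
  by apply: sumr_ge0 => w' _; rewrite mulr_ge0// ltW.
by rewrite indicE mem_set ?mul1r//; exact: sigma_atom_refl.
Qed.

(** A block is the union of the cells of the common refinement at its points. *)
Lemma join_partitions_sub PS Q : (forall Q', PS Q' -> is_partition Q') -> PS Q ->
  Q `<=` join_partitions PS.
Proof.
move=> PSp PSQ B QB.
have sJ : sigma_algebra setT (join_partitions PS) by exact: smallest_sigma_algebra.
have -> : B = \bigcup_(w in B) \bigcap_(Q' in PS) blk Q' w.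
  apply/seteqP; split => w.
    move=> Bw; exists w => // Q' /PSp[_ _ /(_ w)[C [QC Cw]]].
    by exists C.
  move=> [w' Bw' /(_ _ PSQ)[C [QC Cw' Cw]]].
  by have [_ uniqQ _] := PSp _ PSQ; rewrite (uniqQ B C)//; exists w'.
by apply: sigma_bigcup => // w Bw; apply: sub_sigma_algebra; exists w.
Qed.

End Information.

(** * Completing the information of a coalition by null agents *)

Section Bridge.
Context {R : realType} {d : measure_display} {T : measurableType d} {Om : finType}
  {Y : completeNormedModType R}.
Variable E : economy R T Om Y.
Hypothesis setupE : standing_setup E.

Lemma mu_fin_E : (mu E setT < +oo)%E.
Proof. by have [_ [_ ? _ _ _] _ _ _] := setupE. Qed.

Lemma mu_complete_E : measure_is_complete (mu E).
Proof. by have [_ [? _ _ _ _] _ _ _] := setupE. Qed.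

Lemma T1E : T1 E = ~` T0 E.
Proof.
have [_ [_ _ [U01 I01] _ _] _ _ _] := setupE.
apply/seteqP; split => t.
  by move=> t1 t0; have : (T0 E `&` T1 E) t by []; rewrite I01.
by move=> nt0; have : (T0 E `|` T1 E) t; [rewrite U01|case].
Qed.

Lemma measurable_T0 : measurable (T0 E).
Proof. by have [_ [_ _ _ [? _] _] _ _ _] := setupE. Qed.

Lemma measurable_T1 : measurable (T1 E).
Proof. by rewrite T1E; apply: measurableC; exact: measurable_T0. Qed.

Lemma atomless_T0 : forall A, measurable A -> A `<=` T0 E -> (0 < mu E A)%E ->
  exists B, [/\ measurable B, B `<=` A, (0 < mu E B)%E & (mu E B < mu E A)%E].
Proof. by have [_ [_ _ _ [_ ?] _] _ _ _] := setupE. Qed.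

(* One atomless agent per information partition: there are finitely many partitions
   and points of the atomless part are negligible. *)
Lemma partition_representatives : exists N, [/\ N `<=` T0 E, (mu E).-negligible N &
  forall t, T0 E t -> exists2 r, N r & Pi E r = Pi E t].
Proof.
have /choice[rep repP] : forall Q, exists r,
    (exists2 t, T0 E t & Pi E t = Q) -> T0 E r /\ Pi E r = Q.
  move=> Q; have [[t t0 tQ]|h] := pselect (exists2 t, T0 E t & Pi E t = Q).
    by exists t.
  by exists point.
(* Encoding by the finite type [{set {set Om}}] makes the partitions enumerable through
   [unpickle]. *)
pose dec (K : {set {set Om}}) : set (set Om) := [set A | exists2 B, B \in K & A = [set` B]].
have decP Q : exists K, dec K = Q.
  exists (finset (fun B : {set Om} => `[< Q [set` B] >])); apply/seteqP; split => A.
    by move=> [B]; rewrite inE => /asboolP QB ->.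
  move=> QA; exists (finset (fun w : Om => `[< A w >])); last first.
    by apply/seteqP; split => w /=; rewrite inE => /asboolP.
  rewrite inE; apply/asboolP; rewrite (_ : [set` _] = A)//.
  by apply/seteqP; split => w /=; rewrite inE => /asboolP.
exists (T0 E `&` range rep); split; first exact: subIsetl.
  pose F n := if @unpickle {set {set Om}} n is Some K then T0 E `&` [set rep (dec K)]
    else set0.
  apply: (@negligibleS _ _ _ _ (\bigcup_n F n)).
    move=> t [t0 [Q _ Qt]]; have [K KQ] := decP Q.
    by exists (pickle K) => //; rewrite /F pickleK KQ; split => //; rewrite -Qt.
  apply: negligible_bigcup => n; rewrite /F.
  case: unpickle => [K|]; last exact: negligible_set0.
  have [t0|nt0] := pselect (T0 E (rep (dec K))).
    apply: negligibleS (atomless_set1_negligible mu_fin_E measurable_T0 atomless_T0 t0).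
    exact: subIsetr.
  rewrite (_ : _ `&` _ = set0); first exact: negligible_set0.
  by apply/seteqP; split => // t [t0 tE]; apply: nt0; rewrite -tE.
move=> t t0; have [r0 rQ] := repP (Pi E t) (ex_intro2 _ _ t t0 erefl).
by exists (rep (Pi E t)) => //; split => //; exists (Pi E t).
Qed.

Lemma RW_fine_blocked_of_large S w0 (f : T -> Om -> Y) (h : T -> Y) :
  A6 E -> A8 E -> A9 E -> S_allocation E setT f -> coalition E S ->
  S `&` T1 E !=set0 -> (forall t, S t -> Yp E (h t)) ->
  int_eq (mu E) S h (fun t => a E t w0) ->
  {ae mu E, forall t, S t -> U E t w0 (f t w0) < U E t w0 (h t)} ->
  exists2 S', coalition E S' & RW_fine_blocked E f S'.
Proof.
move=> a6 a8 a9 [fP _ fmeas] [mS S0] [s1 [Ss1 T1s1]] hP [y [Hh Ha]] fh.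
have [sF_sigma _ [coneP _] [Pi_part q_pos] [aP a_cst _]] := setupE.
have cmu := mu_complete_E.
have [N [NT0 Nnegl NP]] := partition_representatives.
have mN : measurable (N `\` S) by apply: cmu; exact: negligibleS Nnegl.
have NSnegl : (mu E).-negligible (N `\` S) by exact: negligibleS Nnegl.
pose S' := S `|` (N `\` S).
have mS' : measurable S' by exact: measurableU.
(* [N] supplies the partitions held by small agents; the common partition of the large ones comes
   from [s1]. *)
have PS'T : P_S E S' = P_S E setT.
  apply/seteqP; split => Q [t [S't tQ]]; first by exists t.
  have [t0|nt0] := pselect (T0 E t).
    have [r Nr rt] := NP t t0; exists r; split; last by rewrite /T_Q/= rt.
    by have [Sr|nSr] := pselect (S r); [left|right].
  exists s1; split; first by left.
  have T1t : T1 E t by rewrite T1E.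
  by have [_ _ Pst _] := a6 _ _ T1s1 T1t; rewrite /T_Q/= Pst.
pose A := sigma_atom (sF E) w0.
(* By (A8) every block of every agent belongs to [sF], so the atom [A] lies within a single block
   and endowments do not vary on it. *)
have Pi_sF t : Pi E t `<=` sF E.
  rewrite -a8; apply: join_partitions_sub; last by exists t.
  by move=> Q [u [_ <-]].
have a_atom w t : A w -> a E t w = a E t w0.
  move=> Aw; have [_ _ /(_ w0)[B [QB Bw0]]] := Pi_part t.
  exact: (a_cst t B) (Aw _ (Pi_sF _ _ QB) Bw0) Bw0.
(* A state-independent bundle is measurable for [sF] and balances with the endowments on all of [A],
   where these are constant. The adjoined null agents only need some value in the cone. *)
pose g t (_ : Om) := if `[< S t >] then h t else a E t w0.
have gS t w : S t -> g t w = h t by move=> St; rewrite /g asboolT.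
have SN0 : S `&` (N `\` S) = set0 by rewrite setDIK.
have int_g w : bochner_int (mu E) S' (fun t => g t w) y.
  rewrite -[y]addr0; apply: bochner_int_setU => //.
    by apply: (bochner_int_eq (f := h)) Hh => t St; rewrite gS.
  exact: bochner_int_null.
have int_a w : A w -> bochner_int (mu E) S' (fun t => a E t w) y.
  move=> Aw; rewrite -[y]addr0; apply: bochner_int_setU => //.
    by apply: (bochner_int_eq (f := fun t => a E t w0)) Ha => t St; rewrite a_atom.
  exact: bochner_int_null.
exists S'; first by split => //; rewrite (lt_le_trans S0)// le_measure ?inE//; exact: subsetUl.
exists g, (fun=> sF E), A; split.
- split; [|by move=> w; exists y|by apply: aeW => t _; exact: Gmeas_cst].
  by move=> t w _; rewrite /g; case: asboolP => [/hP|_].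
- split; first by move=> t _; split.
    move=> K _; have [<-|sK] := pselect (sF E = K).
      by rewrite (_ : [set _ | _] = S')//; apply/seteqP; split => t // [].
    by rewrite (_ : [set _ | _] = set0)//; apply/seteqP; split => t // [].
  apply: aeW => t _; rewrite PS'T a8; split => //.
  by apply: smallest_sub.
- by split; [exists w0; exact: sigma_atom_refl|move=> _ _; exact: sigma_atom_mem].
- by move=> w Aw; exists y; split; [exact: int_g|exact: int_a].
- move=> w Aw; have NSae : {ae mu E, forall t, ~ (N `\` S) t}.
    by apply: negligibleS NSnegl => t /= /contrapT.
  have fmeas' : {ae mu E, forall t, Gmeas (sF E) (f t)}.
    by apply: filterS fmeas => t; exact.
  near=> t => S't.
  have nNS : ~ (N `\` S) t by near: t.
  have St : S t by case: S't.
  have ft : Gmeas (sF E) (f t) by near: t.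
  have Ut x : Yp E x -> Gmeas (sF E) (fun w => U E t w x) by move: x; near: t.
  have lt_fh : U E t w0 (f t w0) < U E t w0 (h t) by move: St; near: t.
  have q0 : forall w', 0 < q E t w' by case: (q_pos t).
  rewrite (cond_exp_atom (c := U E t w0 (f t w0)))//; last first.
    move=> w' /(sigma_atom_trans Aw) Aw'; rewrite (Gmeas_atom ft Aw').
    by apply: (Gmeas_atom (Ut _ _) Aw'); exact: fP.
  rewrite (cond_exp_atom (c := U E t w0 (h t)))//.
  move=> w' /(sigma_atom_trans Aw) Aw'; rewrite gS//.
  by apply: (Gmeas_atom (Ut _ _) Aw'); exact: hP.
Unshelve. all: by end_near. Qed.

End Bridge.

(** * Bringing a large agent into a coalition of small ones *)

Section LargeAgents.
Context {R : realType} {d : measure_display} {T : measurableType d} {Om : finType}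
  {Y : completeNormedModType R}.
Variable E : economy R T Om Y.
Hypothesis setupE : standing_setup E.

Let mufin := mu_fin_E setupE.
Let cmu := mu_complete_E setupE.
Let mT0 := measurable_T0 setupE.
Let mT1 := measurable_T1 setupE.

Lemma measurable_set1_T1 t : T1 E t -> measurable [set t] /\ 0 < rmeas (mu E) [set t].
Proof.
have [_ [_ _ _ _ [_ T1P]] _ _ _] := setupE.
by move=> /T1P[mt t0]; split => //; rewrite rmeas_gt0.
Qed.

(** Every subset of [T1] is a countable union of measurable points. *)
Lemma measurable_fun_T1 d' (V : measurableType d') (F : T -> V) : measurable_fun (T1 E) F.
Proof.
have [_ [_ _ _ _ [cT1 T1P]] _ _ _] := setupE.
move=> _ B mB; set A := T1 E `&` _.
have /countable_injP[i injT1] := cT1.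
have -> : A = \bigcup_n (A `&` i @^-1` [set n]).
  by apply/seteqP; split => [t At|t [n _ []//]]; exists (i t).
apply: bigcupT_measurable => n.
have [[t [At itn]]|] := pselect (A `&` i @^-1` [set n] !=set0).
  rewrite (_ : _ `&` _ = [set t]); first by apply: (T1P t _).1; case: At.
  apply/seteqP; split => [t' [At' it'n]|_ -> //].
  by apply: injT1; rewrite ?inE ?it'n//; [case: At'|case: At].
by move/set0P/negP/negbNE/eqP => ->.
Qed.

(* If every large agent strictly preferred its own bundle to the average, so would the
   mean of the utilities, against (A4). *)
Lemma large_agent_prefers_average w0 (f : T -> Om -> Y) y :
  A4 E -> A6 E -> T1 E !=set0 -> feasible E f ->
  bochner_int (mu E) (T1 E) (fun t => f t w0) y ->
  exists2 t, T1 E t &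
    U E t w0 (f t w0) <= U E t w0 ((rmeas (mu E) (T1 E))^-1 *: y).
Proof.
move=> a4 a6 [t1 T1t1] [[fP fint _] fle] Hy.
have [mt1 t1_gt0] := measurable_set1_T1 T1t1.
set m := rmeas (mu E) (T1 E).
have m0 : 0 < m.
  by rewrite (lt_le_trans t1_gt0)//; apply: le_rmeas => // _ ->.
set u := U E t1 w0 (m^-1 *: y).
apply: contrapT => none.
have lt_u t : T1 E t -> u < U E t1 w0 (f t w0).
  move=> T1t; rewrite ltNge; apply/negP => le_u; apply: none; exists t => //.
  by have [-> _ _ _] := a6 _ _ T1t T1t1.
(* [F] is not known to be integrable. Truncation at [u + 1] keeps it above [u], bounds it, and can
   only lower an integral that (A4) bounds by [m * u]. *)
pose F t := U E t1 w0 (f t w0); pose F' t := Num.min (F t) (u + 1).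
have mF : measurable_fun (T1 E) (EFin \o F) by exact: measurable_fun_T1.
have mF' : measurable_fun (T1 E) (EFin \o F') by exact: measurable_fun_T1.
have F'u t : T1 E t -> u < F' t by move=> /lt_u h; rewrite lt_min h ltrDl ltr01.
have muT1 : (0 < mu E (T1 E))%E by rewrite -rmeas_gt0.
have leF : (\int[mu E]_(t in T1 E) (F t)%:E <= (m * u)%:E)%E.
  have muT : (0 < mu E setT)%E by rewrite (lt_le_trans muT1)// le_measure ?inE.
  have T1pos : (0 < mu E (setT `&` T1 E))%E by rewrite setTI.
  have := a4 t1 w0 setT f T1t1 (conj measurableT muT) T1pos (conj fP fint) fle y.
  by rewrite setTI => /(_ Hy) /=; rewrite -[fine _]/m lee_pdivrMl// -EFinM.
have leF' : (\int[mu E]_(t in T1 E) (F' t)%:E <= \int[mu E]_(t in T1 E) (F t)%:E)%E.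
  have F'F : {in T1 E, forall t, ((EFin \o F') t <= (EFin \o F) t)%E}.
    by move=> t _; rewrite lee_fin ge_min lexx.
  rewrite integralE [leRHS]integralE; apply: leeB; apply: ge0_le_integral => //.
  - exact: measurable_funepos.
  - exact: measurable_funepos.
  - by move=> t T1t; apply: (funepos_le F'F); rewrite inE.
  - exact: measurable_funeneg.
  - exact: measurable_funeneg.
  - by move=> t T1t; apply: (funeneg_le F'F); rewrite inE.
have T1lty : (mu E (T1 E) < +oo)%E by rewrite ltey_eq mu_fin.
have intF' : (mu E).-integrable (T1 E) (EFin \o F').
  apply: measurable_bounded_integrable => //; first exact: measurable_fun_T1.
  exists (`|u| + 1); split => // x xgt t T1t /=; rewrite (le_trans _ (ltW xgt))//.
  rewrite ler_norml; apply/andP; split.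
    rewrite lerNl (le_trans _ (_ : `|u| <= _)) ?lerDl// -normrN.
    by rewrite (le_trans _ (ler_norm _))// lerN2 ltW// F'u.
  by rewrite ge_min lerD2r ler_norm orbT.
have intu : (mu E).-integrable (T1 E) (EFin \o cst u).
  apply: measurable_bounded_integrable => //.
  by exists `|u|; split => // x xgt t _; exact: ltW.
have int0 : (\int[mu E]_(t in T1 E) `|(F' t)%:E - u%:E| = 0)%E.
  transitivity (\int[mu E]_(t in T1 E) ((F' t)%:E - (cst u t)%:E))%E.
    apply: eq_integral => t /[!inE] /F'u lt_uF'.
    by rewrite gee0_abs// -EFinB lee_fin subr_ge0 ltW.
  apply/eqP; rewrite eq_le; apply/andP; split.
    rewrite integralB_EFin//= integral_cst// (rmeasE mufin mT1).
    rewrite leeBlDl// adde0 -EFinM mulrC.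
    exact: le_trans leF' leF.
  by apply: integral_ge0 => t /F'u lt_uF'; rewrite -EFinB lee_fin subr_ge0 ltW.
have : (mu E).-negligible (T1 E).
  have mFu : measurable_fun (T1 E) (fun t => (F' t)%:E - u%:E)%E.
    exact: measurable_fun_T1.
  move/(ae_eq_integral_abs _ mT1 mFu) : int0; apply: negligibleS => t T1t /= /(_ T1t).
  by move=> /eqP; rewrite -EFinB eqe subr_eq0 gt_eqF// F'u.
by move/(measure_negligible mT1) => h; rewrite h ltxx in muT1.
Qed.

Lemma large_coalition_blocks w0 (f : T -> Om -> Y) (S : set T) (g : T -> Y) :
  A2 E -> A3 E -> A4 E -> A5 E -> A6 E -> A7 E -> feasible E f ->
  coalition E S -> S `<=` T0 E -> (forall t, S t -> Yp E (g t)) ->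
  int_eq (mu E) S g (fun t => a E t w0) ->
  {ae mu E, forall t, S t -> U E t w0 (f t w0) < U E t w0 (g t)} ->
  exists S' h, [/\ coalition E S', S' `&` T1 E !=set0,
    (forall t, S' t -> Yp E (h t)), int_eq (mu E) S' h (fun t => a E t w0) &
    {ae mu E, forall t, S' t -> U E t w0 (f t w0) < U E t w0 (h t)}].
Proof.
move=> [mU cU] a3 a4 a5 a6 [ta [tb [T1ta T1tb tab]]] ffeas [mS S0] ST0 Pg
  [ya [Hg Ha]] fg.
have [[fP fint _] fle] := ffeas.
have [_ _ [coneP _] _ [aP _ aint]] := setupE.
pose f0 t := f t w0; pose a0 t := a E t w0; pose V t := U E t w0.
have intS (A : set T) (k : T -> Y) : measurable A -> bochner_integrable (mu E) setT k ->
    bochner_integrable (mu E) A k.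
  by move=> mA; apply: (bochner_integrable_sub mufin cmu measurableT mA).
have [yfS HfS] := intS _ f0 mS (fint w0).
(* (A5) puts the aggregate endowment of [S], which is the integral of [g], in the interior, as
   freeing resources from [g] requires. *)
have Pya : (Yp E)° ya.
  by apply: (bochner_int_interior mufin cmu coneP mS S0 _ Ha) => t _; exact: a5.
have [g' [z [Pg' Hg' Pz fg']]] : exists g' z, [/\ forall t, S t -> Yp E (g' t),
    bochner_int (mu E) S g' (ya - z), (Yp E)° z &
    {ae mu E, forall t, S t -> V t (f0 t) < V t (g' t)}].
  apply: (strict_preference_slack mufin cmu coneP (V := V) _ _ mS _ Pg HfS Hg Pya fg).
  - by move=> x Px; exact: mU.
  - by move=> t; exact: cU.
  - by move=> t _; exact: fP.
have [yf1 Hf1] := intS _ f0 mT1 (fint w0).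
have [ts T1ts tsP] :=
  large_agent_prefers_average a4 a6 (ex_intro _ ta T1ta) ffeas Hf1.
set m1 := rmeas (mu E) (T1 E) in tsP; set fhat := _ *: yf1 in tsP.
have [mts ms0] := measurable_set1_T1 T1ts.
set ms := rmeas (mu E) [set ts] in ms0.
have ms_lt : ms < m1.
  have [tc T1tc tcs] : exists2 tc, T1 E tc & tc <> ts.
    by have [tas|] := pselect (ta = ts); [exists tb => //; rewrite -tas => /esym|exists ta].
  have [mtc tc0] := measurable_set1_T1 T1tc.
  apply: (@lt_le_trans _ _ (ms + rmeas (mu E) [set tc])); first by rewrite ltrDl.
  rewrite -rmeasU//; last by apply/seteqP; split => // t [/= -> /esym].
  by apply: le_rmeas => //; [exact: measurableU|move=> t [->|->]].
have m10 : 0 < m1 by exact: lt_trans ms_lt.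
pose al := ms / m1; pose ep := 1 - al.
have al01 : 0 < al < 1 by rewrite divr_gt0//= ltr_pdivrMr// mul1r.
have ep0 : 0 < ep by rewrite subr_gt0; case/andP: al01.
have Pfhat : Yp E fhat.
  have [_ _ PZ _ _] := coneP; apply: PZ; first by rewrite invr_ge0 ltW.
  by apply: (bochner_int_closed_cone mufin cmu coneP mT1 _ Hf1) => t _; exact: fP.
have [yf [ya' [HfT HaT Pvv]]] := fle w0; set vv := ya' - yf in Pvv.
have Hv : bochner_int (mu E) setT (fun t => f0 t - a0 t) (yf - ya') by exact: bochner_intB.
have [v0 [v1 [Hv0 Hv1 vE]]] := bochner_int_split mufin cmu measurableT mT0 (@subsetT _ _) Hv.
rewrite setTD -(T1E setupE) in Hv1.
have v1E : v1 = yf1 - m1 *: a0 ts.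
  apply: (bochner_int_uniq mufin cmu mT1 Hv1); apply: bochner_intB => //.
  apply: (bochner_int_eq (f := cst (a0 ts))); last exact: bochner_int_cst.
  by move=> t T1t; rewrite /a0; have [_ -> _ _] := a6 _ _ T1ts T1t.
have mTS : measurable (T0 E `\` S) by exact: measurableD.
(* Extension by 0 lets a single [D] inside [T0] take the fraction [ep] of two net trades: that of
   [g'] on [S] and that of [f0] on all of [T0]. *)
pose uS t := if `[< S t >] then g' t - a0 t else 0.
have uS1 t : S t -> uS t = g' t - a0 t by move=> St; rewrite /uS asboolT.
have uS0 t : ~ S t -> uS t = 0 by move=> St; rewrite /uS asboolF.
have Hu : bochner_int (mu E) (T0 E) uS (- z).
  have -> : - z = (ya - z - ya) + rmeas (mu E) (T0 E `\` S) *: 0.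
    by rewrite scaler0 addr0 addrAC subrr add0r.
  rewrite -[X in bochner_int _ X](setDUK ST0).
  apply: (bochner_int_setU cmu mS mTS (setDIK _ _)).
    apply: (bochner_int_eq (f := fun t => g' t - a0 t)); first by move=> t /uS1.
    exact: bochner_intB.
  apply: (bochner_int_eq (f := cst 0)); first by move=> t [_ /uS0].
  exact: bochner_int_cst.
have /cone_interiorP[e e0 eP] : (Yp E)° (ep *: z) by exact: cone_interiorZ.
(* Two Lyapunov errors of [e / 4] move [ep *: z] by at most [e / 2] and leave it a ball of radius
   [e / 2] inside the cone. *)
have e4 : 0 < e / 4 by rewrite divr_gt0.
have ep01 : 0 <= ep <= 1 by rewrite /ep; case/andP: al01 => h1 h2; apply/andP; split; lra.
have [D [u' [v' [mD DT0 [Hu' Hv'] u'le v'le]]]] := bochner_fraction mufin cmu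
  (atomless_T0 setupE) mT0 (@subset_refl _ _) Hu Hv0 ep01 e4.
have mDS := measurableI _ _ mD mS; have mDDS := measurableD mD mDS.
have Hu'S : bochner_int (mu E) (D `&` S) (fun t => g' t - a0 t) u'.
  have [u1 [u2 [H1 H2 u'E]]] :=
    bochner_int_split mufin cmu mD mDS (@subIsetl _ _ _) Hu'.
  have u20 : u2 = 0.
    rewrite -(scaler0 _ (rmeas (mu E) (D `\` (D `&` S)))).
    apply: (bochner_int_uniq mufin cmu mDDS H2).
    apply: (bochner_int_eq (f := cst 0)); last exact: bochner_int_cst.
    by move=> t [Dt nDS]; rewrite uS0// => St; apply: nDS.
  rewrite u'E u20 addr0; apply: (bochner_int_eq (f := uS)) H1 => t [_ St].
  exact: uS1.
have mC2 := measurableD mT0 mD.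
have HC2 : bochner_int (mu E) (T0 E `\` D) (fun t => f0 t - a0 t) (v0 - v').
  have [w1 [w2 [H1 H2 v0E]]] := bochner_int_split mufin cmu mT0 mD DT0 Hv0.
  by rewrite v0E (bochner_int_uniq mufin cmu mD Hv' H1) addrAC subrr add0r.
have DT1 t : D t -> ~ T1 E t by move=> /DT0 t0; rewrite (T1E setupE).
have T1T0 t : T1 E t -> ~ T0 E t by rewrite (T1E setupE).
pose S12 := (D `&` S) `|` (T0 E `\` D); pose S' := S12 `|` [set ts].
have mS12 : measurable S12 by exact: measurableU.
have mS' : measurable S' by exact: measurableU.
pose h0 t := if `[< D t >] then g' t else if `[< T0 E t >] then f0 t else fhat.
have h0D t : D t -> h0 t = g' t by move=> Dt; rewrite /h0 asboolT.
have h0T0 t : T0 E t -> ~ D t -> h0 t = f0 t by move=> ? ?; rewrite /h0 asboolF// asboolT.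
have h0T1 t : T1 E t -> h0 t = fhat.
  by move=> T1t; rewrite /h0 asboolF ?asboolF//; [exact: T1T0|move=> /DT1].
(* [ru] is the aggregate net trade before the surplus is handed out: about [- (ep *: z)] from [D],
   about [al *: v0] from the other small agents, and exactly [al *: v1] from the large one. *)
pose ru := u' + (v0 - v') + ms *: (fhat - a0 ts).
have Hh0 : bochner_int (mu E) S' (fun t => h0 t - a0 t) ru.
  apply: bochner_int_setU => //.
  - by apply/seteqP; split => // t [] /[swap] -> [[/DT1]|[/(T1T0 _ T1ts)]].
  - apply: bochner_int_setU => //.
    + by apply/seteqP; split => // t [[Dt _] [_]].
    + by apply: (bochner_int_eq (f := fun t => g' t - a0 t)) Hu'S => t [/h0D ->].
    + apply: (bochner_int_eq (f := fun t => f0 t - a0 t)) HC2 => t [t0 nD].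
      by rewrite h0T0.
  - apply: (bochner_int_eq (f := cst (fhat - a0 ts))); first by move=> _ ->; rewrite h0T1.
    exact: bochner_int_cst.
have ruE : - ru = (ep *: z + ((v' - ep *: v0) - (u' - ep *: - z))) + al *: vv.
  rewrite /ru; have -> : ms *: (fhat - a0 ts) = al *: v1.
    have alm1 : al * m1 = ms by rewrite divfK// gt_eqF.
    by rewrite v1E /fhat !scalerBr !scalerA -/al alm1.
  have -> : vv = - (v0 + v1) by rewrite -vE opprB.
  have -> : ep *: v0 = v0 - al *: v0 by rewrite scalerBl scale1r.
  rewrite !scalerN opprK scalerDr !opprD opprK.
  rewrite [v' + _]addrA (addrA _ (- u')) [ep *: z + _]addrC subrK.
  rewrite opprK (addrAC _ (al *: v0)) [RHS]addrA addrK.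
  by rewrite (addrC (- v0)) (addrC (- u')).
have Pru : (Yp E)° (- ru).
  rewrite ruE; apply: cone_interiorD => //; last first.
    by have [_ _ PZ _ _] := coneP; apply: PZ => //; case/andP: al01 => /ltW.
  apply/cone_interiorP; exists (e / 2); first by rewrite divr_gt0.
  move=> x xe; rewrite -addrA; apply: eP.
  rewrite (le_lt_trans (ler_normD _ _))// (le_lt_trans (lerD (ler_normB _ _) (lexx _)))//.
  lra.
pose ms' := rmeas (mu E) S'.
have ms'0 : 0 < ms' by rewrite (lt_le_trans ms0)//; apply: le_rmeas => // t ->; right.
pose ex := ms'^-1 *: - ru.
have Pex : (Yp E)° ex by apply: cone_interiorZ => //; rewrite invr_gt0.
have Ph0 t : S' t -> Yp E (h0 t).
  move=> [[[Dt St]|[t0 nD]]|->].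
  - by rewrite h0D//; exact: Pg'.
  - by rewrite h0T0//; exact: fP.
  - by rewrite h0T1.
have [yS' HaS'] := intS _ a0 mS' (aint w0).
exists S', (fun t => h0 t + ex); split.
- by split=> //; rewrite -rmeas_gt0.
- by exists ts; split => //; right.
- move=> t S't; have [_ PD _ _ _] := coneP; apply: PD; first exact: Ph0.
  exact: cone_interiorW.
- exists yS'; split => //.
  have := bochner_intD cmu mS' (bochner_intD cmu mS' Hh0 HaS') (bochner_int_cst _ ex mS').
  rewrite scalerA divff ?gt_eqF// scale1r addrAC subrr add0r.
  by apply: bochner_int_eq => t _; rewrite subrK.
- apply: filterS fg' => t /[swap] S't fg't.
  apply: le_lt_trans (a3 t w0 (h0 t) ex (Ph0 t S't) Pex).
  case: S't => [[[Dt St]|[t0 nD]]|tE].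
  + by rewrite h0D// ltW// fg't.
  + by rewrite h0T0.
  + by rewrite tE h0T1.
Qed.

End LargeAgents.

Theorem theorem4p12 (R : realType) (d : measure_display) (T : measurableType d)
  (Om : finType) (Y : completeNormedModType R) (E : economy R T Om Y)
  (f : T -> Om -> Y) :
  standing_setup E ->
  A1 E -> A2 E -> A3 E -> A4 E -> A5 E -> A6 E -> A7 E -> A8 E -> A9 E ->
  RW_fine_core E f -> ex_post_core E f.
Proof.
move=> setupE a1 a2 a3 a4 a5 a6 a7 a8 a9 [ffeas core]; split => // S [mS S0].
have [falloc _] := ffeas.
move=> [g [w0 [[gP _ _] Hga fg]]].
suff [S' cS' blocked] : exists2 S', coalition E S' & RW_fine_blocked E f S'.
  exact: core cS' blocked.
have [ST1|ST1] := pselect (S `&` T1 E !=set0).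
  exact: (RW_fine_blocked_of_large setupE a6 a8 a9 falloc (conj mS S0) ST1
    (fun t St => gP t w0 St) Hga fg).
have ST0 : S `<=` T0 E.
  move=> t St; apply: contrapT => nt0; apply: ST1; exists t; split => //.
  by rewrite (T1E setupE).
have [S' [h [cS' S'T1 hP Hha fh]]] := large_coalition_blocks setupE a2 a3 a4 a5 a6 a7
  ffeas (conj mS S0) ST0 (fun t St => gP t w0 St) Hga fg.
exact: (RW_fine_blocked_of_large setupE a6 a8 a9 falloc cS' S'T1 hP Hha fh).
Qed.
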